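(* Let $\Lambda$ be a finite dimensional algebra over a field and let $f$ be a morphism in $\mathrm{mod}\,\Lambda$. Let $C(f)$ be the direct sum of the indecomposable modules of the form $\tau^{-1}X$, where $X$ is an indecomposable direct summand of the intrinsic kernel of $f$, and of the indecomposable projective modules which almost factor through $f$, one from each isomorphism class. Then: (1) For a module $C\in\mathrm{mod}\,\Lambda$, $f$ is right $C$-determined if and only if $C(f)\in\mathrm{add}_{\Lambda}C$. (2) If $f$ is irreducible, then $$C(f)=\tau^{-1}\mathrm{Ker}\,f\oplus\Big(\bigoplus P_i\Big),$$ where all $P_i$ are pairwise non-isomorphic indecomposable projective modules almost factoring through $f$.
   Context: $\mathrm{mod}\,\Lambda$ is the category of finitely generated left $\Lambda$-modules, and $\tau$ is the Auslander–Reiten translation. For $C\in\mathrm{mod}\,\Lambda$, $\mathrm{add}_{\Lambda}C$ is the full subcategory of $\mathrm{mod}\,\Lambda$ consisting of direct summands of finite direct sums of copies of $C$. A morphism $f:X\to Y$ in $\mathrm{mod}\,\Lambda$ is right $C$-determined (right determined by $C$) if the following holds: for every morphism $f':X'\to Y$ such that $f'\phi$ factors through $f$ for all $\phi\in\mathrm{Hom}_{\Lambda}(C,X')$, the morphism $f'$ factors through $f$. If $f:B\to D$ is a morphism with $B=B_1\oplus B_2$ such that $B_1\subseteq\mathrm{Ker}\,f$ and $f|_{B_2}$ is right minimal, then $\mathrm{Ker}\,f|_{B_2}$ is called the intrinsic kernel of $f$. An indecomposable projective module $P$ almost factors through $f:M\to N$ if there are morphisms $u:\mathrm{rad}\,P\to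 M$ and $h:P\to N$ with $h\iota=fu$, where $\iota:\mathrm{rad}\,P\to P$ is the inclusion of the radical, such that $\mathrm{Im}\,h\not\subseteq\mathrm{Im}\,f$. The module $C(f)$ is called the minimal right determiner of $f$. *)

(* Defs.v *)
From HB Require Import structures.
From mathcomp Require Import all_boot all_algebra all_field.
From mathcomp Require Import boolp functions.

Set Implicit Arguments.
Unset Strict Implicit.
Unset Printing Implicit Defensive.

Import GRing.Theory.
Local Open Scope ring_scope.

Definition surjective (S T : Type) (g : S -> T) : Prop :=
  forall y, exists x, g x = y.

Section Submodules.
Variables (R : pzRingType) (M : lmodType R).

Record submod (U : submodClosed M) := Submod {
  submod_val :> M;
  submod_valP : submod_val \in U
}.

HB.instance Definition _ (U : submodClosed M) := [isSub for @submod_val U].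
HB.instance Definition _ (U : submodClosed M) := [Choice of submod U by <:].
HB.instance Definition _ (U : submodClosed M) :=
  [SubChoice_isSubLmodule of submod U by <:].

Definition maximal_submod (U : submodClosed M) : Prop :=
  (exists x, x \notin U) /\
  forall V : submodClosed M, {subset U <= V} -> (exists x, x \notin V) ->
    {subset V <= U}.

Definition rad_pred : {pred M} :=
  [pred x | `[< forall U : submodClosed M, maximal_submod U -> x \in U >]].

Fact rad_submod_closed : submod_closed rad_pred.
Proof.
split=> [|a x y /asboolP Rx /asboolP Ry]; apply/asboolP=> U maxU.
  exact: rpred0.
by rewrite rpredD ?rpredZ ?Rx ?Ry.
Qed.

HB.instance Definition _ :=
  GRing.isSubmodClosed.Build R M rad_pred rad_submod_closed.

Definition mod_rad : submodClosed M := rad_pred.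

Definition internal_dsum (U V : submodClosed M) : Prop :=
  (forall x, x \in U -> x \in V -> x = 0) /\
  forall x, exists2 u, u \in U & exists2 v, v \in V & x = u + v.
End Submodules.

Section Kernel.
Variables (R : pzRingType) (M N : lmodType R) (f : {linear M -> N}).

Definition ker_pred : {pred M} := [pred x | f x == 0].

Fact ker_submod_closed : submod_closed ker_pred.
Proof.
split=> [|a x y /eqP fx0 /eqP fy0]; apply/eqP; first exact: linear0.
by rewrite linearP fx0 fy0 scaler0 addr0.
Qed.

HB.instance Definition _ :=
  GRing.isSubmodClosed.Build R M ker_pred ker_submod_closed.

Definition mod_ker : submodClosed M := ker_pred.
End Kernel.

Definition dsum (R : pzRingType) (n : nat) (M : 'I_n -> lmodType R) :=
  {dffun forall i, M i}.

Section DirectSum.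
Variables (R : pzRingType) (n : nat) (M : 'I_n -> lmodType R).
Implicit Types u v w : dsum M.

HB.instance Definition _ := Choice.copy (dsum M) {dffun forall i, M i}.

Definition dsum_zero : dsum M := finfun (fun i => 0 : M i).
Definition dsum_opp u : dsum M := finfun (fun i => - u i).
Definition dsum_add u v : dsum M := finfun (fun i => u i + v i).
Definition dsum_scale (a : R) u : dsum M := finfun (fun i => a *: u i).

Fact dsum_addA : associative dsum_add.
Proof. by move=> u v w; apply/ffunP=> i; rewrite !ffunE addrA. Qed.
Fact dsum_addC : commutative dsum_add.
Proof. by move=> u v; apply/ffunP=> i; rewrite !ffunE addrC. Qed.
Fact dsum_add0 : left_id dsum_zero dsum_add.
Proof. by move=> u; apply/ffunP=> i; rewrite !ffunE add0r. Qed.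
Fact dsum_addN : left_inverse dsum_zero dsum_opp dsum_add.
Proof. by move=> u; apply/ffunP=> i; rewrite !ffunE addNr. Qed.

HB.instance Definition _ := GRing.isZmodule.Build (dsum M)
  dsum_addA dsum_addC dsum_add0 dsum_addN.

Fact dsum_scaleA a b u : dsum_scale a (dsum_scale b u) = dsum_scale (a * b) u.
Proof. by apply/ffunP=> i; rewrite !ffunE scalerA. Qed.
Fact dsum_scale1 : left_id 1 dsum_scale.
Proof. by move=> u; apply/ffunP=> i; rewrite !ffunE scale1r. Qed.
Fact dsum_scaleDr : right_distributive dsum_scale +%R.
Proof. by move=> a u v; apply/ffunP=> i; rewrite !ffunE scalerDr. Qed.
Fact dsum_scaleDl u : {morph dsum_scale^~ u : a b / a + b}.
Proof. by move=> a b; apply/ffunP=> i; rewrite !ffunE scalerDl. Qed.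

HB.instance Definition _ := GRing.Zmodule_isLmodule.Build R (dsum M)
  dsum_scaleA dsum_scale1 dsum_scaleDr dsum_scaleDl.
End DirectSum.

Section Modules.
Variable R : pzRingType.
Implicit Types B C D L M N P X Y Z : lmodType R.

Definition fin_gen M : Prop :=
  exists (n : nat) (v : 'I_n -> M),
    forall x, exists a : 'I_n -> R, x = \sum_(i < n) a i *: v i.

Definition isomorphic M N : Prop := exists g : {linear M -> N}, bijective g.

Definition zero_module M : Prop := forall x : M, x = 0.

Definition direct_summand X M : Prop :=
  exists Y, isomorphic M (X * Y)%type.

Definition in_add C M : Prop :=
  exists n : nat, direct_summand M (dsum (fun _ : 'I_n => C)).

Definition indecomposable M : Prop :=
  ~ zero_module M /\
  forall X Y, isomorphic M (X * Y)%type -> zero_module X \/ zero_module Y.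

Definition projective P : Prop :=
  forall X Y (g : {linear X -> Y}) (h : {linear P -> Y}),
    surjective g -> exists h' : {linear P -> X}, forall p, h p = g (h' p).

Definition factors_through X M N (f : {linear M -> N}) (g : {linear X -> N})
  : Prop := exists h : {linear X -> M}, forall x, g x = f (h x).

Definition right_determined X Y (f : {linear X -> Y}) C : Prop :=
  forall (X' : lmodType R) (f' : {linear X' -> Y}), fin_gen X' ->
    (forall phi : {linear C -> X'}, factors_through f (f' \o phi)) ->
    factors_through f f'.

Definition right_minimal M N (f : {linear M -> N}) : Prop :=
  forall g : {linear M -> M}, (forall x, f (g x) = f x) -> bijective g.

(* Isomorphism-invariant in L: the decomposition B = B1 (+) B2 is not unique,
   but Ker f|_{B2} is unique up to isomorphism. *)
Definition intrinsic_kernel B D (f : {linear B -> D}) L : Prop :=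
  exists B1 B2 : submodClosed B,
    let f2 : {linear submod B2 -> D} := f \o \val in
    [/\ internal_dsum B1 B2, {subset B1 <= mod_ker f}, right_minimal f2
      & isomorphic L (submod (mod_ker f2))].

Definition almost_factors P M N (f : {linear M -> N}) : Prop :=
  exists (u : {linear submod (mod_rad P) -> M}) (h : {linear P -> N}),
    (forall x : submod (mod_rad P), h (\val x) = f (u x)) /\
    ~ (forall p, exists m, h p = f m).

Definition split_mono M N (f : {linear M -> N}) : Prop :=
  exists g : {linear N -> M}, cancel f g.

Definition split_epi M N (f : {linear M -> N}) : Prop :=
  exists g : {linear N -> M}, cancel g f.

Definition irreducible_map M N (f : {linear M -> N}) : Prop :=
  [/\ ~ split_mono f, ~ split_epi f &
      forall X (h : {linear M -> X}) (g : {linear X -> N}), fin_gen X ->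
        (forall x, f x = g (h x)) -> split_mono h \/ split_epi g].

(* A surjection p such that g is surjective as soon as p \o g is. *)
Definition essential_epi P Y (p : {linear P -> Y}) : Prop :=
  surjective p /\
  forall Z (g : {linear Z -> P}), surjective (p \o g) -> surjective g.

Definition projective_cover P Y (p : {linear P -> Y}) : Prop :=
  [/\ fin_gen P, projective P & essential_epi p].

(* P1 -d-> P0 -p-> Y -> 0 exact, with p and P1 ->> Ker p projective covers. *)
Definition minimal_presentation P1 P0 Y
    (d : {linear P1 -> P0}) (p : {linear P0 -> Y}) : Prop :=
  projective_cover p /\
  exists2 d' : {linear P1 -> submod (mod_ker p)},
    projective_cover d' & forall x, d x = \val (d' x).

(* M is a complete irredundant list of the isomorphism classes of modules
   satisfying S. *)
Definition representatives (S : lmodType R -> Prop) (n : nat)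
    (M : 'I_n -> lmodType R) : Prop :=
  [/\ forall i, S (M i),
      forall i j, isomorphic (M i) (M j) -> i = j
    & forall X, S X -> exists i, isomorphic X (M i)].
End Modules.

Section Dual.
Variables (K : fieldType) (A : falgType K).

(* D X = Hom_K(X, K), where K acts on X through k |-> k%:A; right A-modules are modules over
   the converse ring A^c. *)
Section Vector.
Variable X : lmodType A.

Definition dual_pred : {pred X -> K} :=
  [pred phi | `[< forall (k : K) (x y : X),
                    phi (k%:A *: x + y) = k * phi x + phi y >]].

Fact dual_zmod_closed : zmod_closed dual_pred.
Proof.
split=> [|phi psi /asboolP linphi /asboolP linpsi]; apply/asboolP=> k x y.
  by rewrite -[LHS]/0 -[RHS]/(k * 0 + 0) mulr0 addr0.
have E z : (phi - psi) z = phi z - psi z by [].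
by rewrite !E linphi linpsi mulrBr opprD addrACA.
Qed.

HB.instance Definition _ :=
  GRing.isZmodClosed.Build (X -> K) dual_pred dual_zmod_closed.

Record kdual := Dual {
  dual_fun :> X -> K;
  dual_funP : dual_fun \in dual_pred
}.

HB.instance Definition _ := [isSub for dual_fun].
HB.instance Definition _ := [Choice of kdual by <:].
HB.instance Definition _ := [SubChoice_isSubZmodule of kdual by <:].

Fact dual_scale_subproof (a : A^c) (phi : kdual) :
  (fun x => phi ((a : A) *: x)) \in dual_pred.
Proof.
apply/asboolP=> k x y; have ka : (a : A) * k%:A = k%:A * (a : A).
  by rewrite -scalerAr mulr1 -scalerAl mul1r.
by rewrite scalerDr scalerA ka -scalerA; move/asboolP: (dual_funP phi); apply.
Qed.

(* (phi a)(x) = phi (a x). *)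
Definition dual_scale (a : A^c) (phi : kdual) : kdual :=
  Dual (dual_scale_subproof a phi).

Fact dual_scaleA a b phi :
  dual_scale a (dual_scale b phi) = dual_scale (a * b) phi.
Proof. by apply/val_inj/funext=> x /=; rewrite scalerA. Qed.
Fact dual_scale1 : left_id 1 dual_scale.
Proof. by move=> phi; apply/val_inj/funext=> x /=; rewrite scale1r. Qed.
Fact dual_scaleDr : right_distributive dual_scale +%R.
Proof. by move=> a phi psi; apply/val_inj/funext=> x. Qed.
Fact dual_scaleDl phi : {morph dual_scale^~ phi : a b / a + b}.
Proof.
move=> a b; apply/val_inj/funext=> x /=; rewrite -[RHS]/(phi ((a : A) *: x) + phi ((b : A) *: x)).
rewrite scalerDl.
move/asboolP: (dual_funP phi) => /(_ 1 ((a : A) *: x) ((b : A) *: x)).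
by rewrite !scale1r mul1r.
Qed.

HB.instance Definition _ := GRing.Zmodule_isLmodule.Build A^c kdual
  dual_scaleA dual_scale1 dual_scaleDr dual_scaleDl.
End Vector.

Section Regular.
Variable P : lmodType A^c.

Definition hom_pred : {pred P -> A^o} :=
  [pred phi | `[< forall (a : A) (x y : P),
                    phi ((a : A^c) *: x + y) = (phi x : A) * a + phi y >]].

Fact hom_submod_closed : submod_closed hom_pred.
Proof.
split=> [|b phi psi /asboolP linphi /asboolP linpsi]; apply/asboolP=> a x y.
  by rewrite -[LHS]/0 -[RHS]/(0 * a + 0) mul0r addr0.
have E z : (b *: phi + psi) z = (b : A) * (phi z : A) + psi z by [].
by rewrite !E linphi linpsi mulrDr mulrDl mulrA addrACA.
Qed.

HB.instance Definition _ :=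
  GRing.isSubmodClosed.Build A (P -> A^o) hom_pred hom_submod_closed.

(* For a right module P, Hom_A(P, A) as a left module: (b phi)(x) = b phi(x). *)
Definition regular_dual := submod (hom_pred : submodClosed (P -> A^o)).
End Regular.

(* T is a tau^-1 X = Tr D X: for a minimal projective presentation
   P1 -d-> P0 -> D X -> 0 of right modules, T is a cokernel of
   Hom_A(d, A) : Hom_A(P0, A) -> Hom_A(P1, A). *)
Definition tau_inv (X T : lmodType A) : Prop :=
  exists (P1 P0 : lmodType A^c) (d : {linear P1 -> P0})
         (p : {linear P0 -> kdual X}) (c : {linear regular_dual P1 -> T}),
    [/\ minimal_presentation d p, surjective c &
        forall phi : regular_dual P1,
          c phi = 0 <->
          exists psi : regular_dual P0, forall x, \val phi x = \val psi (d x)].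

Section Determiner.
Variables (M N : lmodType A) (f : {linear M -> N}).

Definition tau_inv_of_intrinsic_kernel (Z : lmodType A) : Prop :=
  indecomposable Z /\
  exists L X : lmodType A,
    [/\ intrinsic_kernel f L, indecomposable X, direct_summand X L
      & tau_inv X Z].

Definition almost_factoring_projective (P : lmodType A) : Prop :=
  [/\ fin_gen P, projective P, indecomposable P & almost_factors P f].

(* C is a C(f), which is defined up to isomorphism. *)
Definition minimal_right_determiner (C : lmodType A) : Prop :=
  exists (n : nat) (Z : 'I_n -> lmodType A),
    representatives (fun Y => tau_inv_of_intrinsic_kernel Y \/
                              almost_factoring_projective Y) Z /\
    isomorphic C (dsum Z).
End Determiner.
End Dual.

(* Main.v *)
(* For a minimal presentation P1 -> P0 -> D X -> 0 of right modules and T = tau^-1 X,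
   there is an exact sequence, natural in M,
     0 -> Hom(T, M) -> Hom(P1*, M) -> Hom(P0*, M) -> D Hom(M, X) -> 0.
   By the snake lemma, for 0 -> L -> E -> W -> 0 exact, the maps T -> W modulo those
   that lift to E are dual to the maps L -> X modulo those that extend to E.  Hence f is
   right determined by the projectives and the tau^-1 X, with X running through the
   indecomposable summands of its intrinsic kernel L; a projective is only needed if it
   almost factors through f.  Conversely, right minimality of f : E -> D implies that no
   map E -> X restricts to a split epimorphism L -> X, so that there is a functional on
   Hom(L, X) that kills every map that is not a split epimorphism, but not the projection.
   It corresponds to a map tau^-1 X -> D that does not factor through f, although its
   composite with every map to tau^-1 X that is not a split epimorphism does; this forces
   tau^-1 X into add C as soon as f is right C-determined.  An irreducible map has
   an indecomposable kernel (or is injective), which gives the second part. *)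

From HB Require Import structures.
Require Import Defs.
From mathcomp Require Import all_boot all_algebra all_field.
From mathcomp Require Import boolp functions.

Set Implicit Arguments.
Unset Strict Implicit.
Unset Printing Implicit Defensive.

Import GRing.Theory.
Local Open Scope ring_scope.

(** * Linear maps and direct summands *)

Section LinearMaps.
Variable R : pzRingType.
Implicit Types L M N P X Y Z : lmodType R.

(** The exact sequence of Hom spaces is never formed. Its last term is reached through P0 (x) L,
    read as Hom(P0^*, L) by means of a dual basis: a map g : P0^* -> L acts on Hom(L, X) by
    [pairing], and enough functionals arise in this way because P0 -> D X is onto ([pairing_sep]).
    Exactness at Hom(P0^*, -) is split into [pairing_rdual] and [pairing_factor], and the connecting
    map of the snake lemma into [connecting_exists] and [connecting_lift]. On morphisms, tau^-1 is a
    functor only modulo maps through injectives and projectives, so it enters as the relation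
    [transports]; what matters is that a split epimorphism Y -> X forces one between the translates.
    Functionals that kill all maps which are not split epimorphisms exist because these maps form a
    subspace, which is where local endomorphism rings, and hence Fitting's lemma, come in. Finally
    tau^-1 X vanishes for injective X, so zero translates have to be set apart before a module can
    count as a summand of C(f). *)

Definition mklin M N (f : M -> N)
    (fP : forall a x y, f (a *: x + y) = a *: f x + f y) : {linear M -> N} :=
  HB.pack_for {linear M -> N} f (GRing.isLinear.Build R M N *:%R f fP).

(** Taking [a = 0] in the second hypothesis shows that [y] is unique, so any choice function for [r]
    is linear. Maps that come from a diagram chase are built this way. *)
Lemma choose_linear M N (r : M -> N -> Prop) :
    (forall x, exists y, r x y) ->
    (forall a x x' y y' z, r x y -> r x' y' -> r (a *: x + x') z ->
       z = a *: y + y') ->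
  exists f : {linear M -> N}, forall x, r x (f x).
Proof.
move=> /choice[f fP] lin; have fL a x y : f (a *: x + y) = a *: f x + f y.
  exact: lin (fP x) (fP y) (fP _).
by exists (mklin fL).
Qed.

Lemma factor_surj M N X (c : {linear M -> N}) (k : {linear M -> X}) :
    surjective c -> (forall x, c x = 0 -> k x = 0) ->
  exists h : {linear N -> X}, forall x, h (c x) = k x.
Proof.
move=> cS kP; have kE x y : c x = c y -> k x = k y.
  by move=> cE; apply/eqP; rewrite -subr_eq0 -linearB kP // linearB cE subrr.
have [||h hP] := @choose_linear N X (fun n z => forall x, c x = n -> z = k x).
- by move=> n; have [x xn] := cS n; exists (k x) => y yn; apply: kE; rewrite xn.
- move=> a n n' y y' z; have [x xn] := cS n; have [x' xn'] := cS n'.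
  move=> /(_ _ xn)-> /(_ _ xn')-> /(_ (a *: x + x'))->; rewrite linearP //.
  by rewrite xn xn'.
by exists h => x; apply: hP.
Qed.

Lemma lin_inj M N (f : {linear M -> N}) :
  (forall x, f x = 0 -> x = 0) <-> injective f.
Proof.
split=> [f0 x y fE|fI x fx0]; last by apply: fI; rewrite linear0.
by apply/eqP; rewrite -subr_eq0; apply/eqP/f0; rewrite linearB fE subrr.
Qed.

Lemma factor_inj L M X (i : {linear L -> M}) (k : {linear X -> M}) :
    injective i -> (forall x, exists y, i y = k x) ->
  exists h : {linear X -> L}, forall x, i (h x) = k x.
Proof.
move=> iI kP; apply: (@choose_linear X L (fun x y => i y = k x)) => //.
by move=> a x x' y y' z yE yE' zE; apply: iI; rewrite zE !linearP yE yE'.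
Qed.

Lemma bijP M N (f : {linear M -> N}) : bijective f <-> injective f /\ surjective f.
Proof.
split=> [[g fK gK]|[fI fS]]; first by split; [exact: can_inj fK | move=> y;
  exists (g y)].
have [g gP] := choice fS; exists g => // x; exact: fI.
Qed.

Lemma linear_inv M N (f : {linear M -> N}) : bijective f ->
  exists g : {linear N -> M}, cancel f g /\ cancel g f.
Proof.
move=> /bijP[fI fS]; have [g gP] := factor_inj (k := idfun) fI fS.
by exists g; split=> // x; apply: fI; rewrite gP.
Qed.

Lemma bijective_comp_lin L M N (f : {linear L -> M}) (g : {linear M -> N}) :
  bijective f -> bijective g -> bijective (g \o f).
Proof. by move=> fB gB; apply: bij_comp. Qed.

Lemma isomorphic_refl M : isomorphic M M.
Proof. by exists idfun; exists idfun. Qed.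

Lemma isomorphic_sym M N : isomorphic M N -> isomorphic N M.
Proof. by case=> f /linear_inv[g [fK gK]]; exists g; exists f. Qed.

Lemma isomorphic_trans L M N : isomorphic L M -> isomorphic M N -> isomorphic L N.
Proof. by case=> f fB [g gB]; exists (g \o f); apply: bijective_comp_lin. Qed.

Lemma isomorphic_zero M N : isomorphic M N -> zero_module M -> zero_module N.
Proof. by case=> f [g fK gK] M0 y; rewrite -(gK y) (M0 (g y)) linear0. Qed.

Lemma prod_lin M X Y (f : {linear M -> X}) (g : {linear M -> Y}) :
  exists h : {linear M -> (X * Y)%type}, forall x, h x = (f x, g x).
Proof.
have hL a x y : (f (a *: x + y), g (a *: x + y)) = a *: (f x, g x) + (f y, g y).
  by rewrite !linearP.
by exists (mklin hL).
Qed.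

Lemma coprod_lin M X Y (f : {linear X -> M}) (g : {linear Y -> M}) :
  exists h : {linear (X * Y)%type -> M}, forall x y, h (x, y) = f x + g y.
Proof.
have hL a (u v : (X * Y)%type) :
    f (a *: u + v).1 + g (a *: u + v).2 = a *: (f u.1 + g u.2) + (f v.1 + g v.2).
  by rewrite /= !linearP scalerDr addrACA.
by exists (mklin hL).
Qed.

Lemma sum_lin M N (I : finType) (f : I -> {linear M -> N}) :
  exists h : {linear M -> N}, forall x, h x = \sum_i f i x.
Proof.
have hL a x y : \sum_i f i (a *: x + y) = a *: (\sum_i f i x) + \sum_i f i y.
  by rewrite scaler_sumr -big_split; apply: eq_bigr => i _; rewrite linearP.
by exists (mklin hL).
Qed.

Lemma corestrict M (U : submodClosed M) X (k : {linear X -> M}) :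
  (forall x, k x \in U) -> exists h : {linear X ->
    submod U}, forall x, \val (h x) = k x.
Proof.
move=> kU; apply: (factor_inj (i := \val)); first exact: val_inj.
by move=> x; exists (Submod (kU x)).
Qed.

Lemma submodB M (U : submodClosed M) x y : x \in U -> y \in U -> x - y \in U.
Proof. by move=> Ux Uy; rewrite -scaleN1r rpredD // rpredZ. Qed.

Definition retract X M := exists (i : {linear X -> M}) (r : {linear M ->
    X}), cancel i r.

Lemma retractP X M : direct_summand X M <-> retract X M.
Proof.
split=> [[Y [f /linear_inv[g [fK gK]]]]|[i [r rK]]].
  have [i iE] := prod_lin (idfun : {linear X -> X}) (\0 : {linear X -> Y}).
  exists (g \o i), (fst \o f) => x /=; by rewrite gK iE.
(* The complement of the image of [i] is the kernel of [r], onto which [e] projects. *)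
pose e : {linear M -> M} := idfun \- (i \o r).
have [|e' eE] := @corestrict _ (mod_ker r) M e.
  by move=> x; rewrite inE /e /= linearB rK subrr.
have [h hE] := prod_lin r e'; exists (submod (mod_ker r)), h; apply/bijP; split.
  apply/lin_inj => x; rewrite hE => -[r0 /(congr1 \val)]; rewrite eE /= r0.
  by rewrite linear0 subr0.
case=> y z; exists (i y + \val z); rewrite hE; congr (_, _).
  by rewrite linearD rK; have /eqP-> := valP z; rewrite addr0.
apply: val_inj; rewrite eE /e /= linearD rK; have /eqP-> := valP z.
by rewrite addr0 addrC addKr.
Qed.

Lemma retract_trans X Y Z : retract X Y -> retract Y Z -> retract X Z.
Proof.
move=> [i [r rK]] [j [s sK]]; exists (j \o i), (r \o s) => x /=.
by rewrite sK rK.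
Qed.

Lemma isomorphic_retract X Y : isomorphic X Y -> retract X Y.
Proof. by move=> [f /linear_inv[g [fK gK]]]; exists f, g. Qed.

Lemma indecomposable_retract X M : indecomposable M -> retract X M ->
  ~ zero_module X -> isomorphic X M.
Proof.
move=> [_ Mi] /retractP[Y MXY] X0; have [//|Y0] := Mi _ _ MXY.
apply: isomorphic_sym; apply: isomorphic_trans MXY _; exists fst; apply/bijP; split.
  by apply/lin_inj => -[x y] /= ->; rewrite (Y0 y).
by move=> x; exists (x, 0).
Qed.

(* M is the direct sum of the kernels of [1 - e] and [e]. *)
Lemma indecomposable_idem M (e : {linear M -> M}) : indecomposable M ->
  (forall x, e (e x) = e x) -> (forall x, e x = 0) \/ (forall x, e x = x).
Proof.
move=> [_ Mi] ee; have [|e1 e1E] := @corestrict M (mod_ker (idfun \- e)) M e.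
  by move=> x; rewrite inE /= ee subrr.
have [|e2 e2E] := @corestrict M (mod_ker e) M (idfun \- e).
  by move=> x; rewrite inE /= linearB ee subrr.
have [h hE] := prod_lin e1 e2;
  have [|im0|ker0] := Mi (submod (mod_ker (idfun \- e))) (submod (mod_ker e)).
- exists h; apply/bijP; split.
    apply/lin_inj => x; rewrite hE => -[/(congr1 \val) + /(congr1 \val)].
    by rewrite e1E e2E /= => ->; rewrite subr0.
  case=> y z; exists (\val y + \val z); rewrite hE.
  have yE : e (\val y) = \val y.
    by have := valP y; rewrite inE /= subr_eq0 => /eqP.
  have zE : e (\val z) = 0 by have := valP z; rewrite inE => /eqP.
  congr (_, _); apply: val_inj; rewrite ?e1E ?e2E /= linearD yE zE addr0 //.
  by rewrite addrC addKr.
- by left=> x; rewrite -e1E (im0 (e1 x)).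
- right=> x; apply/eqP; rewrite eq_sym -subr_eq0; have := e2E x.
  by rewrite (ker0 (e2 x)) /= => <-.
Qed.

Definition im_pred M N (f : {linear M -> N}) : {pred N} :=
  [pred y | `[< exists x, f x = y >]].

Fact im_submod_closed M N (f : {linear M -> N}) : submod_closed (im_pred f).
Proof.
split=> [|a x y /asboolP[u <-] /asboolP[v <-]]; apply/asboolP.
  by exists 0; rewrite linear0.
by exists (a *: u + v); rewrite linearP.
Qed.

HB.instance Definition _ M N (f : {linear M -> N}) :=
  GRing.isSubmodClosed.Build R N (im_pred f) (im_submod_closed f).

Definition mod_im M N (f : {linear M -> N}) : submodClosed N := im_pred f.

Lemma mod_imP M N (f : {linear M -> N}) y :
  reflect (exists x, f x = y) (y \in mod_im f).
Proof. exact: asboolP. Qed.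

Definition preim_pred M N (f : {linear M -> N}) (U : submodClosed N) : {pred M} :=
  [pred x | f x \in U].

Fact preim_submod_closed M N (f : {linear M -> N}) (U : submodClosed N) :
  submod_closed (preim_pred f U).
Proof.
split=> [|a x y]; rewrite !inE ?linear0 ?rpred0 // => Ux Uy.
by rewrite linearP rpredD // rpredZ.
Qed.

HB.instance Definition _ M N (f : {linear M -> N}) (U : submodClosed N) :=
  GRing.isSubmodClosed.Build R M (preim_pred f U) (preim_submod_closed f U).

Definition mod_preim M N (f : {linear M -> N}) (U : submodClosed N) :
  submodClosed M := preim_pred f U.

End LinearMaps.

(** * Dimension *)

(** A matrix of maximal rank with row space inside [S] works: adjoining a further vector of [S]
    would raise the rank. *)
Lemma subspace_mx (K : fieldType) n (S : 'rV[K]_n -> Prop) :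
    S 0 -> (forall a x y, S x -> S y -> S (a *: x + y)) ->
  exists G : 'M[K]_n, forall x, S x <-> (x <= G)%MS.
Proof.
move=> S0 SL.
pose good r := `[< exists G : 'M[K]_n, (forall x, (x <= G)%MS -> S x) /\ \rank G = r >].
have [||r /asboolP[G [GS <-]] Gmax] := @ex_maxnP good n.
- by exists 0%N; apply/asboolP; exists 0; rewrite mxrank0; split=> // x;
  rewrite submx0 => /eqP->.
- by move=> r /asboolP[G [_ <-]]; apply: rank_leq_row.
exists G => x; split; last exact: GS.
move=> Sx; suff: (G + x <= G)%MS by rewrite addsmx_sub => /andP[].
rewrite -(geq_leqif (mxrank_leqif_sup (addsmxSl G x))); apply: Gmax; apply/asboolP.
exists (G + x)%MS; split=> // y /sub_addsmxP[[u v] /= ->].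
rewrite addrC (mx11_scalar v) mul_scalar_mx; apply: SL => //; apply: GS; exact: submxMl.
Qed.

Section Dimension.
Variables (K : fieldType) (A : falgType K).
Implicit Types L M N P X Y Z : lmodType A.

(** [K] acts on an [A]-module only through [k%:A], so a dimension is witnessed by coordinates that
    are linear for this action. *)
Definition has_dim M n := exists c : M -> 'rV[K]_n,
  (forall k x y, c (k%:A *: x + y) = k *: c x + c y) /\ bijective c.

Lemma fin_gen_has_dim M : fin_gen M -> exists n, has_dim M n.
Proof.
move=> [n [v vP]].
pose b := vbasis {: A}; pose m := \dim {: A}; pose N := #|{: 'I_n * 'I_m}|.
pose w (l : 'I_N) := b`_(enum_val l).2 *: v (enum_val l).1.
pose phi (a : 'rV[K]_N) : M := \sum_l (a 0 l)%:A *: w l.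
have phiL k x y : phi (k *: x + y) = k%:A *: phi x + phi y.
  rewrite /phi scaler_sumr -big_split; apply: eq_bigr => l _ /=.
  rewrite !mxE 2!scalerDl; congr (_ + _).
  by rewrite [RHS]scalerA; congr (_ *: _); rewrite -scalerAl mul1r scalerA.
have phiS x : exists a, phi a = x.
  have [a ->] := vP x.
  exists (\row_l coord b (enum_val l).2 (a (enum_val l).1)).
  transitivity (\sum_(p : 'I_n * 'I_m) (coord b p.2 (a p.1))%:A *: (b`_p.2 *: v p.1)).
    rewrite /phi (reindex_onto enum_rank enum_val) => [|l _]; last exact: enum_valK.
    apply: eq_big => [p|p _]; first by rewrite enum_rankK eqxx.
    by rewrite mxE /w enum_rankK.
  rewrite -(pair_bigA _ (fun i j => (coord b j (a i))%:A *: (b`_j *: v i))) /=.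
  apply: eq_bigr => i _.
  rewrite [in RHS](coord_vbasis (memvf (a i))) scaler_suml.
  by apply: eq_bigr => j _; rewrite scalerA mulr_algl.
have phi0 : phi 0 = 0 by rewrite /phi big1 // => l _; rewrite mxE scale0r scale0r.
have phiD x y : phi (x + y) = phi x + phi y.
  by have := phiL 1 x y; rewrite !scale1r.
have [||G GP] := @subspace_mx K N (fun a => phi a = 0) => //.
  by move=> k x y x0 y0; rewrite phiL x0 y0 scaler0 addr0.
(* [G] spans the kernel of the surjection [phi], which becomes bijective on the complement [C]. *)
pose C := row_base (G^C)%MS; pose r := \rank (G^C)%MS.
pose psi (t : 'rV[K]_r) := phi (t *m C).
have psiB : bijective psi.
  suff /choice[g gP] : forall x, exists t, psi t = x.
    exists g => // t; apply/eqP; rewrite -subr_eq0; set d := g _ - t.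
    have d0 : phi (d *m C) = 0.
      have := phiL (-1) (t *m C) (g (psi t) *m C).
      rewrite mulmxBl addrC -scaleN1r -/(psi t) -/(psi (g (psi t))) gP => ->.
      by rewrite !scaleN1r addNr.
    have: (d *m C <= G :&: G^C)%MS.
      by rewrite sub_capmx (proj1 (GP _) d0) (submx_trans (submxMl _ _)) // eq_row_base.
    rewrite capmx_compl submx0 => /eqP dC.
    by apply/eqP; apply: (row_free_inj (row_base_free (G^C)%MS)); rewrite dC mul0mx.
  move=> x; have [a <-] := phiS x.
  have /sub_addsmxP[[u u'] /= aE]: (a <= G + G^C)%MS by rewrite submx_full //
    addsmx_compl_full.
  have /submxP[t tE] : (u' *m (G^C)%MS <= C)%MS by rewrite eq_row_base submxMl.
  exists t; rewrite /psi -tE aE phiD (_ : phi (u *m G) = 0) ?add0r //.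
  by apply/GP; apply: submxMl.
exists r; case: psiB => c psiK cK; exists c; split; last by exists psi.
have psiL k x y : psi (k *: x + y) = k%:A *: psi x + psi y.
  by rewrite /psi mulmxDl -scalemxAl phiL.
by move=> k x y; apply: (can_inj psiK); rewrite psiL !cK.
Qed.

Lemma has_dim_fin_gen M n : has_dim M n -> fin_gen M.
Proof.
move=> [c [cL [d cK dK]]]; exists n, (fun i => d (delta_mx 0 i)) => x.
exists (fun i => (c x 0 i)%:A); apply: (can_inj cK).
have c0 : c 0 = 0.
  by have := cL (-1) 0 0; rewrite scaler0 addr0 scaleN1r addNr.
have cD y z : c (y + z) = c y + c z by have := cL 1 y z; rewrite !scale1r.
rewrite (big_morph c cD c0) [LHS]row_sum_delta; apply: eq_bigr => i _.
by have := cL (c x 0 i) (d (delta_mx 0 i)) 0; rewrite !addr0 c0 addr0 dK => ->.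
Qed.

Lemma dim_coord_lin M N m n (cM : M -> 'rV[K]_m) (cN : N -> 'rV[K]_n)
    (g : {linear M -> N}) :
    (forall k x y, cM (k%:A *: x + y) = k *: cM x + cM y) -> bijective cM ->
    (forall k x y, cN (k%:A *: x + y) = k *: cN x + cN y) ->
  exists H : 'M[K]_(m, n), forall x, cN (g x) = cM x *m H.
Proof.
move=> ML [d cK dK] NL; have hL k x y :
    cN (g (d (k *: x + y))) = k *: cN (g (d x)) + cN (g (d y)).
  rewrite -NL -linearP; congr (cN (g _)); apply: (can_inj cK).
  by rewrite ML !dK.
by exists (lin1_mx (mklin hL)) => x; rewrite mul_rV_lin1 /= cK.
Qed.

Lemma has_dim_surj M N m n (g : {linear M -> N}) :
    has_dim M m -> has_dim N n -> surjective g ->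
  (n <= m)%N /\ (n = m -> injective g).
Proof.
move=> [cM [ML Mb]] [cN [NL [d cNK dK]]] gS.
have [H HP] := dim_coord_lin g ML Mb NL.
have Hf : row_full H.
  apply/row_fullP; pose f (y : 'rV[K]_n) := d y.
  have /choice[h hP] : forall i : 'I_n, exists v : 'rV[K]_m, v *m H = row i 1%:M.
    by move=> i; have [x xE] := gS (d (row i 1%:M)); exists (cM x); rewrite -HP xE dK.
  exists (\matrix_i h i); apply/row_matrixP => i.
  by rewrite row_mul rowK hP.
split; first by rewrite -(eqP Hf) rank_leq_row.
move=> nm; subst m; apply/lin_inj => x gx0; apply: (bij_inj Mb).
have Hfree : row_free H by rewrite /row_free (eqP Hf).
apply: (row_free_inj Hfree); rewrite -!HP gx0.
by rewrite linear0.
Qed.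

Lemma has_dim_uniq M m n : has_dim M m -> has_dim M n -> m = n.
Proof.
move=> Mm Mn; apply/eqP; rewrite eqn_leq.
have idS : surjective (idfun : {linear M -> M}) by move=> x; exists x.
by rewrite (proj1 (has_dim_surj Mm Mn idS)) (proj1 (has_dim_surj Mn Mm idS)).
Qed.

Lemma has_dim_inj M N m (g : {linear N -> M}) : has_dim M m -> injective g ->
  exists r, [/\ (r <= m)%N, has_dim N r & r = m -> surjective g].
Proof.
move=> [c [cL [d cK dK]]] gI; pose S y := exists x, c (g x) = y.
have c0 : c 0 = 0.
  by have := cL (-1) 0 0; rewrite scaler0 addr0 scaleN1r addNr.
have cgL k x y : c (g (k%:A *: x + y)) = k *: c (g x) + c (g y).
  by rewrite linearP cL.
have [||G GP] := @subspace_mx K m S.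
- by exists 0; rewrite linear0.
- by move=> k x y [u <-] [v <-]; exists (k%:A *: u + v).
have cG x : (c (g x) <= row_base G)%MS by rewrite eq_row_base; apply/GP; exists x.
exists (\rank G); split; first exact: rank_leq_row.
  exists (fun x => c (g x) *m pinvmx (row_base G)); split.
    by move=> k x y; rewrite cgL mulmxDl scalemxAl.
  suff /choice[h hP] : forall t, exists x, c (g x) = t *m row_base G.
    exists h => [x|t]; last by rewrite hP mulmxKp // row_base_free.
    by apply: gI; apply: (can_inj cK); rewrite hP mulmxKpV.
  by move=> t; apply/GP; rewrite -(eq_row_base G) submxMl.
move=> rm x; have /GP[y yE] : (c x <= G)%MS by rewrite submx_full // /row_full rm.
by exists y; apply: (can_inj cK).
Qed.

Definition kdim M : nat :=
  if pselect (exists n, has_dim M n) is left e then projT1 (cid e) else 0%N.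

Lemma kdimP M : fin_gen M -> has_dim M (kdim M).
Proof.
by move=> /fin_gen_has_dim Mn; rewrite /kdim; case: pselect => // e; case: (cid e).
Qed.

Lemma fin_gen_inj M N (g : {linear N -> M}) : fin_gen M -> injective g -> fin_gen N.
Proof. by move=> /kdimP Mn /(has_dim_inj Mn)[r [_ Nr _]];
  apply: has_dim_fin_gen Nr. Qed.

Lemma fin_gen_surj M N (g : {linear M -> N}) : fin_gen M -> surjective g -> fin_gen N.
Proof.
move=> [n [v vP]] gS; exists n, (g \o v) => y; have [x <-] := gS y.
have [a ->] := vP x; exists a; rewrite linear_sum; apply: eq_bigr => i _.
by rewrite linearZ.
Qed.

Lemma kdim_inj M N (g : {linear N -> M}) : fin_gen M -> injective g ->
  (kdim N <= kdim M)%N /\ (kdim N = kdim M -> surjective g).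
Proof.
move=> Mf gI; have [r [rm Nr rS]] := has_dim_inj (kdimP Mf) gI.
by rewrite (has_dim_uniq (kdimP (fin_gen_inj Mf gI)) Nr).
Qed.

Lemma kdim_surj M N (g : {linear M -> N}) : fin_gen M -> surjective g ->
  (kdim N <= kdim M)%N /\ (kdim N = kdim M -> injective g).
Proof. by move=> Mf gS; apply: has_dim_surj (kdimP Mf) (kdimP (fin_gen_surj Mf gS))
  gS. Qed.

Lemma surj_endo_bij M (g : {linear M -> M}) : fin_gen M -> surjective g -> bijective g.
Proof. by move=> Mf gS; apply/bijP; split=> //; apply: (proj2 (kdim_surj Mf gS)). Qed.

Lemma inj_endo_bij M (g : {linear M -> M}) : fin_gen M -> injective g -> bijective g.
Proof. by move=> Mf gI; apply/bijP; split=> //; apply: (proj2 (kdim_inj Mf gI)). Qed.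

Lemma surj2_bij M N (f : {linear M -> N}) (g : {linear N -> M}) :
  fin_gen M -> surjective f -> surjective g -> bijective f.
Proof.
move=> Mf fS gS; apply/bijP; split=> //; apply: (proj2 (kdim_surj Mf fS)).
apply/eqP; rewrite eqn_leq (proj1 (kdim_surj Mf fS)).
by rewrite (proj1 (kdim_surj (fin_gen_surj Mf fS) gS)).
Qed.

End Dimension.

(** * Fitting's lemma and the Krull-Schmidt theorem *)

Section Fitting.
Variables (K : fieldType) (A : falgType K).
Implicit Types L M N P X Y Z : lmodType A.

Lemma iter_linear M (g : {linear M -> M}) n :
  exists h : {linear M -> M}, forall x, h x = iter n g x.
Proof.
elim: n => [|n [h hE]]; first by exists idfun.
by exists (g \o h) => x /=; rewrite hE.
Qed.

(* [e] is the projection onto the image of a power of [g], along its kernel. *)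
Lemma fitting M (g : {linear M -> M}) : fin_gen M ->
  exists n (e : {linear M -> M}),
    [/\ forall x, e (e x) = e x,
        forall x, e x = 0 <-> iter n.+1 g x = 0,
        forall x, exists y, e x = iter n.+1 g y
      & forall x, e (iter n.+1 g x) = iter n.+1 g x].
Proof.
move=> Mf.
(* A power [h] of [g] with image of least dimension has the same image as [h \o h], so it is
   bijective on its image. The positive exponent [n.+1] makes [e] vanish on the kernel of [g]. *)
pose Q d := `[< exists n (h : {linear M -> M}),
  (forall x, h x = iter n.+1 g x) /\ kdim (submod (mod_im h)) = d >].
have [|d /asboolP[n [h [hE hd]]] dmin] := @ex_minnP Q.
  have [h hE] := iter_linear g 1.
  by exists (kdim (submod (mod_im h))); apply/asboolP; exists 0%N, h.
have imfg (k : {linear M -> M}) : fin_gen (submod (mod_im k)).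
  by apply: (fin_gen_inj (g := \val)) Mf _; apply: val_inj.
have h2 x : exists y, h x = h (h y).
  have [|j jE] := @corestrict _ _ (mod_im h) (submod (mod_im (h \o h))) \val.
    by case=> z /= /mod_imP[y <-] /=; apply/mod_imP; exists (h y).
  have jI : injective j.
    by move=> u v uv; apply: val_inj; rewrite -!jE uv.
  have [le jS] := kdim_inj (imfg h) jI.
  have hx : h x \in mod_im h by apply/mod_imP; exists x.
  have [|z zE] := jS _ (Submod hx).
    apply/eqP; rewrite eqn_leq le hd; apply: dmin; apply/asboolP.
    exists (n + n.+1)%N, (h \o h); split=> // y.
    by rewrite -[(_ + _).+1]addSn iterD /= !hE.
  have /mod_imP[y yE] := valP z; exists y.
  by have := jE z; rewrite zE /= => ->; rewrite -yE.
have hI x : h (h x) = 0 -> h x = 0.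
  have [|r rE] := @corestrict _ _ (mod_im h) (submod (mod_im h)) (h \o \val).
    by move=> u; apply/mod_imP; exists (\val u).
  have rS : surjective r.
    case=> z zP; have /mod_imP[u uE] := zP; have [y yE] := h2 u.
    have hy : h y \in mod_im h by apply/mod_imP; exists y.
    by exists (Submod hy); apply: val_inj; rewrite rE /= -yE.
  have /bijP[/lin_inj rI _] := surj_endo_bij (imfg h) rS.
  move=> hhx; have hx : h x \in mod_im h by apply/mod_imP; exists x.
  have /(congr1 \val) //: Submod hx = 0.
  by apply: rI; apply: val_inj; rewrite rE.
have uniq z z' : z \in mod_im h -> z' \in mod_im h -> h z = h z' -> z = z'.
  move=> /mod_imP[y <-] /mod_imP[y' <-] hyy; apply/eqP; rewrite -subr_eq0.
  by rewrite -linearB; apply/eqP/hI; rewrite !linearB hyy subrr.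
(* [e x] is the unique [z] in the image of [h] with [h z = h x]. *)
have [||e eP] := @choose_linear _ M M (fun x z => z \in mod_im h /\ h z = h x).
- move=> x; have [y yE] := h2 x; exists (h y); split=> //.
  by apply/mod_imP; exists y.
- move=> a x x' y y' z [yi yE] [y'i y'E] [zi zE]; apply: uniq => //.
    by rewrite rpredD // rpredZ.
  by rewrite zE !linearP yE y'E.
exists n, e; split=> [x|x|x|x].
- by have [i1 E1] := eP x; have [i2 E2] := eP (e x); apply: uniq.
- have [i1 E1] := eP x; rewrite -hE; split=> [e0|h0].
    by rewrite -E1 e0 linear0.
  by apply: uniq; rewrite ?rpred0 // E1 h0 linear0.
- by have [/mod_imP[y yE] _] := eP x; exists y; rewrite -hE yE.
- have hx : h x \in mod_im h by apply/mod_imP; exists x.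
  by rewrite -hE; have [i1 E1] := eP (h x); apply: uniq.
Qed.

(** Fitting's projection for [a] is 0 or the identity. In the first case [a] is nilpotent, so it
    fixes no nonzero vector and [b] is injective; in the second [a] is injective. *)
Lemma indecomposable_endo_local X (a b : {linear X -> X}) :
    fin_gen X -> indecomposable X -> (forall x, a x + b x = x) ->
  bijective a \/ bijective b.
Proof.
move=> Xf Xi ab; have [n [e [ee e0 _ _]]] := fitting a Xf.
case: (indecomposable_idem Xi ee) => eE; [right|left];
  apply: inj_endo_bij => //; apply/lin_inj => x x0.
  have ax : a x = x by rewrite -[RHS]ab x0 addr0.
  have iterx k : iter k a x = x by elim: k => // k /= ->.
  by rewrite -(iterx n.+1); apply/e0.
by rewrite -(eE x); apply/e0; rewrite iterSr x0; elim: n {ee e0} => //= n ->;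
  rewrite linear0.
Qed.

(** By locality either the first summand or the sum of the others is bijective, and the induction
    continues with the latter; this is why the sum may be any bijection. *)
Lemma indecomposable_sum_bij X (I : finType) (a : I -> {linear X ->
    X}) (g : {linear X -> X}) :
    fin_gen X -> indecomposable X -> bijective g ->
    (forall x, \sum_i a i x = g x) ->
  exists i, bijective (a i).
Proof.
move=> Xf Xi gB aE.
suff: forall (s : seq I) (f : {linear X -> X}), bijective f ->
    (forall x, \sum_(i <- s) a i x = f x) -> exists i, bijective (a i).
  by move=> /(_ _ _ gB aE).
elim=> [|i s IHs] f fB fE.
  case: Xi => -[] x; have [h fK _] := fB; apply: (can_inj fK).
  by rewrite linear0 -fE big_nil.
have [f' [fK f'K]] := linear_inv fB.
have f'B : bijective f' by exists f.
case: (@indecomposable_endo_local X (f' \o a i) (idfun \- (f' \o a i))) => //.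
- by move=> x /=; rewrite addrC subrK.
- move=> B; exists i; apply: (eq_bij (bij_comp fB B)) => x /=; exact: f'K.
- move=> B; apply: (IHs (f \- a i)) => [|x]; last first.
    by have := fE x; rewrite big_cons /= => <-; rewrite addrC addKr.
  by apply: (eq_bij (bij_comp fB B)) => x /=; rewrite linearB f'K.
Qed.

(** This makes the maps to [X] that are not split epimorphisms closed under sums, so that a
    functional can be asked to kill exactly these. *)
Lemma split_epiD M X (u v w : {linear M -> X}) :
    fin_gen X -> indecomposable X -> (forall x, w x = u x + v x) ->
  split_epi w -> split_epi u \/ split_epi v.
Proof.
move=> Xf Xi wE [s sK].
have sub (t : {linear M -> X}) : bijective (t \o s) -> split_epi t.
  by move=> /(@linear_inv A X X (t \o s))[r [_ rK]]; exists (s \o r).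
case: (@indecomposable_endo_local X (u \o s) (v \o s)) => //.
- by move=> x /=; rewrite -wE sK.
- by left; apply: sub.
- by right; apply: sub.
Qed.

(** The Krull-Schmidt argument runs on the identity being the sum of the [i k \o r k]; the
    orthogonality relations are kept for [biproduct]. *)
Definition decomposition M (I : finType) (X : I -> lmodType A)
    (i : forall k, {linear X k -> M}) (r : forall k, {linear M -> X k}) :=
  [/\ forall k, indecomposable (X k), forall k, cancel (i k) (r k)
    & forall x, \sum_k i k (r k x) = x].

Lemma decompositionP M : fin_gen M ->
  exists (I : finType) (X : I -> lmodType A) i r, @decomposition M I X i r.
Proof.
have [n] := ubnP (kdim M); elim: n M => // n IHn M; rewrite ltnS => Mn Mf.
have [M0|M0] := EM (zero_module M).
  exists void, (of_void _), (fun v : void => match v with end), (fun v :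
    void => match v with end).
  by split=> [[]|[]|x]; rewrite big_pred0 // => -[].
have [Mi|Mi] := EM (indecomposable M).
  exists unit, (fun=> M), (fun=> idfun), (fun=> idfun).
  by split=> // x; rewrite big_const card_unit /= addr0.
have [X [Y [MXY X0 Y0]]] : exists X Y, [/\ isomorphic M (X * Y)%type,
  ~ zero_module X & ~ zero_module Y].
  have [//|XY] := EM (exists X Y, [/\ isomorphic M (X * Y)%type,
    ~ zero_module X & ~ zero_module Y]).
  case: Mi; split=> // X Y MXY; apply: contrapT => /not_orP[X0 Y0].
  by case: XY; exists X, Y.
have [f [g [fK gK]]] : exists (f : {linear M ->
  (X * Y)%type}) (g : {linear (X * Y)%type -> M}),
    cancel f g /\ cancel g f.
  by case: MXY => f /linear_inv[g fg]; exists f, g.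
have [jX jXE] := prod_lin (idfun : {linear X -> X}) (\0 : {linear X -> Y}).
have [jY jYE] := prod_lin (\0 : {linear Y -> X}) (idfun : {linear Y -> Y}).
have strict (V : lmodType A) (j : {linear V -> (X * Y)%type}) :
    injective j -> ~ surjective j -> fin_gen V /\ (kdim V < n)%N.
  move=> jI jS; have gjI : injective (g \o j).
    by move=> u v /= /(can_inj gK) /jI.
  split; first exact: fin_gen_inj Mf gjI.
  apply: leq_trans Mn; rewrite ltn_neqAle (proj1 (kdim_inj Mf gjI)) andbT.
  apply/eqP => /(proj2 (kdim_inj Mf gjI)) gjS; apply: jS => y.
  by have [x xE] := gjS (g y); exists x; apply: (can_inj gK).
have [||Xf Xn] := strict X jX.
- by move=> u v; rewrite !jXE => -[].
- by move=> jS; apply: Y0 => y; have [x] := jS (0, y); rewrite jXE => -[].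
have [||Yf Yn] := strict Y jY.
- by move=> u v; rewrite !jYE => -[].
- by move=> jS; apply: X0 => y; have [x] := jS (y, 0); rewrite jYE => -[].
have [I [U [i [r [Ui rK irE]]]]] := IHn X Xn Xf.
have [J [V [j [s [Vi sK jsE]]]]] := IHn Y Yn Yf.
pose W k := match k with inl k => U k | inr k => V k end.
pose iW k : {linear W k -> M} :=
  match k with inl k => g \o (jX \o i k) | inr k => g \o (jY \o j k) end.
pose rW k : {linear M -> W k} :=
  match k with inl k => r k \o (fst \o f) | inr k => s k \o (snd \o f) end.
exists (I + J)%type, W, iW, rW; split=> [[]//|[k|k] x /=|x].
- by rewrite gK jXE /= rK.
- by rewrite gK jYE /= sK.
rewrite big_sumType /= -!linear_sum irE jsE jXE jYE /=.
rewrite -linearD (_ : _ + _ = f x) ?fK //.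
by case: (f x) => u v; congr (_, _) => /=; rewrite ?addr0 ?add0r.
Qed.

Lemma retract_fin_gen X M : fin_gen M -> retract X M -> fin_gen X.
Proof. by move=> Mf [i [r rK]]; apply: (fin_gen_inj (g := i)) Mf (can_inj rK). Qed.

(** The identity of [X] is the sum of the maps [s \o i k \o r k \o j], and one of these is
    bijective. *)
Lemma retract_sum X M (I : finType) (U : I -> lmodType A)
    (i : forall k, {linear U k -> M}) (r : forall k, {linear M -> U k}) :
    fin_gen X -> indecomposable X -> retract X M ->
    (forall x, \sum_k i k (r k x) = x) ->
  exists k, retract X (U k).
Proof.
move=> Xf Xi [j [s sK]] irE.
have [||k /linear_inv[h [hK _]]] :=
  @indecomposable_sum_bij X I (fun k => (s \o i k) \o (r k \o j)) idfun Xf Xi.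
- by exists idfun.
- by move=> x /=; rewrite -linear_sum irE sK.
by exists k, (r k \o j), (h \o (s \o i k)).
Qed.

Lemma krull_schmidt X M (I : finType) (U : I -> lmodType A) i r :
    fin_gen M -> indecomposable X -> retract X M -> @decomposition M I U i r ->
  exists k, isomorphic X (U k).
Proof.
move=> Mf Xi XM [Ui _ irE].
have [k XU] := retract_sum (retract_fin_gen Mf XM) Xi XM irE.
by exists k; apply: indecomposable_retract XU _ => //; case: Xi.
Qed.

(** [S] is not assumed invariant under isomorphism, so the representatives are chosen inside [S] and
    not among the [N i]. *)
Lemma representativesP (S : lmodType A -> Prop) (I : finType) (N : I -> lmodType A) :
  (forall X, S X -> exists i, isomorphic X (N i)) ->
  exists n (Z : 'I_n -> lmodType A), representatives S Z.
Proof.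
move=> SN.
(* [pick] depends only on the predicate, so [c] is a canonical index for each isomorphism class. *)
pose c i := odflt i [pick j | `[< isomorphic (N j) (N i) >]].
have cN i : isomorphic (N (c i)) (N i).
  by rewrite /c; case: pickP => [j /asboolP|_] //; apply: isomorphic_refl.
have cE i j : isomorphic (N i) (N j) -> c i = c j.
  move=> ij; rewrite /c (@eq_pick _ _ (fun k => `[< isomorphic (N k) (N j) >])).
    case: pickP => // /(_ j) /asboolP[]; exact: isomorphic_refl.
  by move=> k; apply/asboolP/asboolP => ki; apply: isomorphic_trans ki _ => //;
    apply: isomorphic_sym.
have cK i : c (c i) = c i by apply: cE.
pose J := [set i | `[< exists X, S X /\ isomorphic X (N i) >] && (c i == i)].
have /choice[Z ZP] : forall k : 'I_#|J|, exists X, S X /\ isomorphic X (N (enum_val k)).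
  by move=> k; have := enum_valP k; rewrite inE => /andP[/asboolP].
exists #|J|, Z; split=> [k|k l kl|X SX]; first by case: (ZP k).
  apply: enum_val_inj; have := enum_valP k; have := enum_valP l.
  rewrite !inE => /andP[_ /eqP <-] /andP[_ /eqP <-]; apply: cE.
  have [_ Zk] := ZP k; have [_ Zl] := ZP l.
  exact: isomorphic_trans (isomorphic_sym Zk) (isomorphic_trans kl Zl).
have [i Xi] := SN X SX; have XN : isomorphic X (N (c i)).
  exact: isomorphic_trans Xi (isomorphic_sym (cN i)).
have iJ : c i \in J by rewrite inE cK eqxx andbT; apply/asboolP; exists X.
exists (enum_rank_in iJ (c i)); have [_ Zk] := ZP (enum_rank_in iJ (c i)).
apply: isomorphic_trans XN _; apply: isomorphic_sym.
by rewrite enum_rankK_in in Zk.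
Qed.

Definition biproduct M (I : finType) (X : I -> lmodType A)
    (i : forall k, {linear X k -> M}) (r : forall k, {linear M -> X k}) :=
  [/\ forall k, cancel (i k) (r k), forall k l x, k != l -> r l (i k x) = 0
    & forall x, \sum_k i k (r k x) = x].

Lemma biproduct_iso M N (I J : finType) (X : I -> lmodType A) (Y : J -> lmodType A)
    i r j s (sg : I -> J) :
    @biproduct M I X i r -> @biproduct N J Y j s -> bijective sg ->
    (forall k, isomorphic (X k) (Y (sg k))) ->
  isomorphic M N.
Proof.
move=> [rK r0 irE] [sK s0 jsE] sgB XY.
have [h0 h0P] : exists h : forall k, {linear X k ->
  Y (sg k)}, forall k, bijective (h k).
  exists (fun k => projT1 (cid (XY k))) => k; by case: (cid (XY k)).
have [h' h'P] : exists h : forall k, {linear Y (sg k) -> X k},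
    forall k, cancel (h0 k) (h k) /\ cancel (h k) (h0 k).
  exists (fun k => projT1 (cid (linear_inv (h0P k)))) => k; by case: (cid _).
pose fk k x := j (sg k) (h0 k (r k x)).
have fL a x y : \sum_k fk k (a *: x + y) = a *: \sum_k fk k x + \sum_k fk k y.
  rewrite scaler_sumr -big_split; apply: eq_bigr => k _ /=.
  by rewrite /fk !linearP.
have gL a x y : \sum_k i k (h' k (s (sg k) (a *: x + y))) =
    a *: (\sum_k i k (h' k (s (sg k) x))) + \sum_k i k (h' k (s (sg k) y)).
  by rewrite scaler_sumr -big_split; apply: eq_bigr => k _ /=; rewrite !linearP.
exists (mklin fL), (mklin gL) => [x|y] /=.
  rewrite -[RHS]irE; apply: eq_bigr => k _; congr (i k _).
  rewrite linear_sum (bigD1 k) //= big1 ?addr0 => [|l lk].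
    by rewrite /fk sK; case: (h'P k) => ->.
  by rewrite /fk s0 // (inj_eq (bij_inj sgB)).
rewrite -[RHS]jsE (reindex sg) /=; last by exact: onW_bij.
apply: eq_bigr => k _; rewrite /fk; congr (j _ _).
rewrite linear_sum (bigD1 k) //= big1 ?addr0 => [|l lk].
  by rewrite rK; case: (h'P k) => _ ->.
by rewrite r0.
Qed.

(** Irredundancy makes the two matchings between complete lists mutually inverse. Arbitrary finite
    index types allow a list with one extra entry. *)
Lemma representatives_biproduct_iso (S : lmodType A -> Prop) M N (I J : finType)
    (X : I -> lmodType A) (Y : J -> lmodType A) i r j s :
    @biproduct M I X i r -> @biproduct N J Y j s ->
    (forall k, S (X k)) -> (forall k l, isomorphic (X k) (X l) -> k = l) ->
    (forall V, S V -> exists k, isomorphic V (X k)) ->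
    (forall k, S (Y k)) -> (forall k l, isomorphic (Y k) (Y l) -> k = l) ->
    (forall V, S V -> exists k, isomorphic V (Y k)) ->
  isomorphic M N.
Proof.
move=> Mb Nb SX Xinj Xc SY Yinj Yc.
have /choice[sg sgP] : forall k, exists l, isomorphic (X k) (Y l) by move=> k;
  apply: Yc.
have /choice[tu tuP] : forall k, exists l, isomorphic (Y k) (X l) by move=> k;
  apply: Xc.
apply: (biproduct_iso Mb Nb _ sgP); exists tu => [k|l].
  by apply: Xinj; apply: isomorphic_sym; apply: isomorphic_trans (sgP k) (tuP _).
by apply: Yinj; apply: isomorphic_sym; apply: isomorphic_trans (tuP l) (sgP _).
Qed.
End Fitting.

(** * Injections and projections of finite direct sums *)

Section DirectSumMaps.
Variables (R : pzRingType) (n : nat) (X : 'I_n -> lmodType R).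

Fact dsum_inj_linear k (a : R) (x y : X k) :
  (finfun (dfwith (fun l => 0 : X l) (a *: x + y)) : dsum X) =
  a *: (finfun (dfwith (fun l => 0 : X l) x) : dsum X) +
  (finfun (dfwith (fun l => 0 : X l) y) : dsum X).
Proof.
apply/ffunP => l; rewrite !ffunE; case: (eqVneq k l) => [kl|kl].
  by subst l; rewrite !dfwith_in.
by rewrite !dfwith_out // scaler0 addr0.
Qed.
Definition dsum_inj k : {linear X k -> dsum X} := mklin (@dsum_inj_linear k).

Fact dsum_proj_linear k (a : R) (u v : dsum X) : (a *: u + v) k = a *: u k + v k.
Proof. by rewrite !ffunE. Qed.
Definition dsum_proj k : {linear dsum X -> X k} := mklin (@dsum_proj_linear k).

Lemma dsum_injK k : cancel (@dsum_inj k) (@dsum_proj k).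
Proof. by move=> x /=; rewrite ffunE dfwith_in. Qed.

Lemma dsum_inj_proj k l x : k != l -> dsum_proj l (dsum_inj k x) = 0.
Proof. by move=> kl /=; rewrite ffunE dfwith_out. Qed.

Lemma dsum_sumE u : \sum_k dsum_inj k (dsum_proj k u) = u.
Proof.
apply/ffunP => l.
transitivity (dsum_proj l (\sum_k dsum_inj k (dsum_proj k u))) => //.
rewrite linear_sum (bigD1 l) //= big1 => [|k kl];
  first by rewrite addr0 ffunE dfwith_in.
by have := @dsum_inj_proj k l (u k) kl.
Qed.

Lemma dsum_pair (M : lmodType R) (f : forall k, {linear M -> X k}) :
  exists h : {linear M -> dsum X}, forall k x, dsum_proj k (h x) = f k x.
Proof.
have hL a x y : (finfun (fun k => f k (a *: x + y)) : dsum X) =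
   a *: (finfun (fun k => f k x) : dsum X) + (finfun (fun k => f k y) : dsum X).
  by apply/ffunP => k; rewrite !ffunE linearP.
by exists (mklin hL) => k x /=; rewrite ffunE.
Qed.
End DirectSumMaps.

(** * Projective modules and projective covers *)

Section Projective.
Variables (K : fieldType) (A : falgType K).
Implicit Types L M N P X Y Z : lmodType A.

Definition free n : lmodType A := dsum (fun _ : 'I_n => A^o : lmodType A).

Lemma free_map n Y (v : 'I_n -> Y) :
  exists h : {linear free n -> Y}, forall u, h u = \sum_i (u i : A) *: v i.
Proof.
have hL (a : A) (x y : free n) : \sum_i ((a *: x + y) i : A) *: v i =
    a *: \sum_i (x i : A) *: v i + \sum_i (y i : A) *: v i.
  rewrite scaler_sumr -big_split; apply: eq_bigr => i _ /=.
  by rewrite !ffunE scalerDl -scalerA.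
by exists (mklin hL).
Qed.

Definition free_basis n (i : 'I_n) : free n := dsum_inj (fun _ => A^o) i 1.

Lemma free_basisE n (u : free n) : u = \sum_i (u i : A) *: free_basis i.
Proof.
rewrite -[LHS]dsum_sumE; apply: eq_bigr => i _.
by rewrite /free_basis -linearZ /= -[_ *: _]/(_ * _) mulr1.
Qed.

Lemma free_fin_gen n : fin_gen (free n).
Proof. by exists n, (@free_basis n) => u; exists u; apply: free_basisE. Qed.

Lemma free_projective n : projective (free n).
Proof.
move=> X Y g h gS; have /choice[v vP] : forall i, exists x, g x = h (free_basis i).
  by move=> i; apply: gS.
have [k kE] := free_map v; exists k => u.
rewrite {1}[u]free_basisE kE !linear_sum; apply: eq_bigr => i _.
by rewrite !linearZ /= vP.
Qed.

Lemma fin_gen_free_surj Y : fin_gen Y -> exists n (h : {linear free n ->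
    Y}), surjective h.
Proof.
move=> [n [v vP]]; have [h hE] := free_map v; exists n, h => y.
have [a ->] := vP y; exists (\sum_i a i *: free_basis i).
rewrite linear_sum; apply: eq_bigr => i _; rewrite linearZ /= hE; congr (_ *: _).
rewrite (bigD1 i) //= big1 ?addr0 => [|j ij]; rewrite /free_basis /= ffunE.
  by rewrite dfwith_in scale1r.
by rewrite dfwith_out 1?eq_sym // scale0r.
Qed.

Lemma retract_projective X P : retract X P -> projective P -> projective X.
Proof.
move=> [i [r rK]] Pp U V g h gS; have [k kP] := Pp U V g (h \o r) gS.
by exists (k \o i) => x /=; rewrite -kP /= rK.
Qed.

Lemma projective_split P X (g : {linear X -> P}) : projective P -> surjective g ->
  exists s : {linear P -> X}, cancel s g.
Proof. by move=> /(_ X P g idfun) /[apply] -[s sP]; exists s => x; have <- := sP x. Qed.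

Lemma projective_retract_free P : fin_gen P -> projective P ->
    exists n, retract P (free n).
Proof.
move=> /fin_gen_free_surj[n [h hS]] Pp; have [s sK] := projective_split Pp hS.
by exists n, s, h.
Qed.

(* A projective module of least dimension mapping onto Y is a projective cover:
   by Fitting's lemma, an endomorphism over Y that is not surjective would split
   off a smaller one. *)
Lemma projective_cover_exists Y : fin_gen Y ->
  exists P (p : {linear P -> Y}), projective_cover p.
Proof.
move=> Yf.
pose Q d := `[< exists P (p : {linear P -> Y}),
  [/\ fin_gen P, projective P, surjective p & kdim P = d] >].
have [|d /asboolP[P [p [Pf Pp pS Pd]]] dmin] := @ex_minnP Q.
  have [n [h hS]] := fin_gen_free_surj Yf; exists (kdim (free n)); apply/asboolP.
  by exists (free n), h; split; [exact: free_fin_gen | exact: free_projective | |].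
exists P, p; split=> //; split=> // Z g pgS.
have [s sP] := Pp _ _ (p \o g) p pgS.
have [n [e [ee e0 eim eiter]]] := fitting (g \o s) Pf.
have piter k x : p (iter k (g \o s) x) = p x by elim: k => // k <-; rewrite [RHS]sP.
have [|e' e'E] := @corestrict _ _ (mod_im e) P e; first by move=> x; apply/mod_imP;
  exists x.
have vI : injective (\val : {linear submod (mod_im e) -> P}) by apply: val_inj.
have Ef : fin_gen (submod (mod_im e)) by apply: fin_gen_inj Pf vI.
have vK : cancel (\val : {linear submod (mod_im e) -> P}) e'.
  by case=> u uP; apply: val_inj; rewrite e'E /=; have /mod_imP[x <-] := uP.
have [_ /(_ _)/(_ _) vS] := kdim_inj Pf vI.
have {}vS : surjective (\val : {linear submod (mod_im e) -> P}).
  apply: vS; apply/eqP; rewrite eqn_leq (proj1 (kdim_inj Pf vI)) Pd dmin //.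
  apply/asboolP; exists (submod (mod_im e)), (p \o \val); split=> //.
    by apply: retract_projective Pp; exists \val, e'.
  move=> y; have [x <-] := pS y; exists (e' (iter n.+1 (g \o s) x)).
  by rewrite /= e'E eiter piter.
move=> x; have [[u uP] /= <-] := vS x; have /mod_imP[z <-] := uP.
by have [y ->] := eim z; exists (s (iter n (g \o s) y)).
Qed.

(** Such a projective is a retract of a free module, hence of the regular module, and Krull-Schmidt
    places it among the summands of the latter. *)
Lemma indecomposable_projectives_finite :
  exists (I : finType) (Q : I -> lmodType A), forall P,
    fin_gen P -> projective P -> indecomposable P -> exists i, isomorphic P (Q i).
Proof.
have Af : fin_gen (A^o : lmodType A).
  by exists 1%N, (fun=> 1) => x; exists (fun=> x);
    rewrite big_ord1 -[_ *: _]/(_ * _) mulr1.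
have [I [Q [i [r Qd]]]] := decompositionP Af; exists I, Q => P Pf Pp Pi.
have [n Pn] := projective_retract_free Pf Pp.
have [k PA] := retract_sum Pf Pi Pn (@dsum_sumE _ _ (fun _ => A^o)).
exact: krull_schmidt Af Pi PA Qd.
Qed.

(** A maximal U not containing V satisfies U + V = P. A section of U (+) V -> P writes the identity
    as a sum of endomorphisms with images in U and in V; one is bijective, so U or V is all of P. *)
Lemma proper_subset_rad P (V : submodClosed P) :
    fin_gen P -> projective P -> indecomposable P -> (exists x, x \notin V) ->
  {subset V <= mod_rad P}.
Proof.
move=> Pf Pp Pi [v0 v0V] v vV; apply/asboolP => U [[u0 u0U] Umax].
have [h hE] := coprod_lin (\val : {linear submod U ->
  P}) (\val : {linear submod V -> P}).
have UW : {subset U <= mod_im h}.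
  by move=> u uU; apply/mod_imP; exists (Submod uU, 0); rewrite hE addr0.
have VW : {subset V <= mod_im h}.
  by move=> w wV; apply/mod_imP; exists (0, Submod wV); rewrite hE add0r.
have [hS|hS] := EM (surjective h); last first.
  apply: Umax UW _ _ (VW _ vV); move/existsNP: hS => [y yP]; exists y.
  by apply/mod_imP.
have [s sK] := projective_split Pp hS.
have all (T : submodClosed P) (k : {linear P -> submod T}) x :
    bijective (\val \o k) -> x \in T.
  by case=> g _ gK; rewrite -(gK x) /=; apply: valP.
case: (@indecomposable_endo_local _ _ P (\val \o (fst \o s)) (\val \o (snd \o s)))
  => //.
- by move=> x /=; rewrite -hE -[RHS]sK; case: (s x).
- by move=> /(@all _ _ u0) E; rewrite E in u0U.
- by move=> /(@all _ _ v0) E; rewrite E in v0V.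
Qed.

(* P is the projective cover of a submodule of X minimal among those not mapped
   into W. *)
Lemma local_projective_map X Y (f : {linear X -> Y}) (W : submodClosed Y) :
    fin_gen X -> (exists x, f x \notin W) ->
  exists P (k : {linear P -> X}),
    [/\ fin_gen P, projective P, indecomposable P, exists x, f (k x) \notin W
      & forall x, x \in mod_rad P -> f (k x) \in W].
Proof.
move=> Xf [x0 x0W].
pose Q d := `[< exists N : submodClosed X, kdim (submod N) = d /\
                  exists2 x, x \in N & f x \notin W >].
have [|d /asboolP[N [Nd [x1 x1N x1W]]] dmin] := @ex_minnP Q.
  exists (kdim (submod (mod_im (idfun : {linear X -> X})))); apply/asboolP.
  exists (mod_im (idfun : {linear X -> X})); split=> //; exists x0 => //.
  by apply/mod_imP; exists x0.
have subf (V : submodClosed X) : fin_gen (submod V).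
  by apply: (fin_gen_inj (g := \val)) Xf _; apply: val_inj.
have Nmin (V : submodClosed X) : {subset V <= N} ->
    (exists2 x, x \in V & f x \notin W) -> {subset N <= V}.
  move=> VN VW; have [|j jE] := @corestrict _ _ N (submod V) \val.
    by move=> v; apply: VN; apply: valP.
  have jI : injective j by move=> u v uv; apply: val_inj; rewrite -!jE uv.
  have [le jS] := kdim_inj (subf N) jI.
  move=> x xN; have [|v vE] := jS _ (Submod xN).
    by apply/eqP; rewrite eqn_leq le Nd; apply: dmin; apply/asboolP; exists V.
  by have := jE v; rewrite vE /= => ->; apply: valP.
have [P [p [Pf Pp [pS pess]]]] := projective_cover_exists (subf N).
(* Minimality of [N] makes such a [t] onto modulo the kernel of [p], hence onto. For submodules of
   [P] this shows that the preimage of [W] is maximal, for direct summands that [P] is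
   indecomposable. *)
have ess (T : lmodType A) (t : {linear T -> P}) :
    (exists x, f (\val (p (t x))) \notin W) -> surjective t.
  move=> [z zW]; apply: (pess _ t) => -[n nN].
  have /(_ n nN)/mod_imP[y yE] : {subset N <= mod_im (\val \o (p \o t))}.
    apply: Nmin; first by move=> x /mod_imP[y <-]; apply: valP.
    by exists (\val (p (t z))) => //; apply/mod_imP; exists z.
  by exists y; apply: val_inj.
have [p1 p1E] := pS (Submod x1N).
have kp1 : f (\val (p p1)) \notin W by rewrite p1E.
exists P, (\val \o p); split=> //; last 2 first.
- by exists p1.
- move=> x /asboolP /(_ (mod_preim (f \o (\val \o p)) W)); apply.
  split; first by exists p1.
  move=> V _ [y yV] v vV; rewrite inE; apply/negPn/negP => vW.
  have [|[u uV] uE] := @ess (submod V) \val _ y; first by exists (Submod vV).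
  by rewrite -uE uV in yV.
split=> [P0|U V [g /linear_inv[g' [gK g'K]]]].
  by rewrite (P0 p1) !linear0 rpred0 in kp1.
have [iU iUE] := prod_lin (idfun : {linear U -> U}) (\0 : {linear U -> V}).
have [iV iVE] := prod_lin (\0 : {linear V -> U}) (idfun : {linear V -> V}).
have p1uv : p1 = g' (iU (g p1).1) + g' (iV (g p1).2).
  rewrite -linearD iUE iVE (_ : _ + _ = g p1) ?gK //.
  by case: (g p1) => a b; congr (_, _) => /=; rewrite ?addr0 ?add0r.
have [pU|pU] := boolP (f (\val (p (g' (iU (g p1).1)))) \in W); [left=> u|right=> v].
  have [|v vE] := @ess V (g' \o iV) _ (g' (u, 0)).
    exists (g p1).2 => /=; apply: contra kp1 => pV.
    by rewrite p1uv !linearD rpredD.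
  by move: vE => /= /(can_inj g'K); rewrite iVE => -[].
have [|u uE] := @ess U (g' \o iU) _ (g' (0, v)); first by exists (g p1).1.
by move: uE => /= /(can_inj g'K); rewrite iUE => -[].
Qed.

End Projective.

(** * Duality *)

Section ConverseAlgebra.
Variables (K : fieldType) (A : falgType K).

(** With a finite dimensional algebra structure on [A^c], the results on dimension and projective
    covers apply to right modules. The two compatibility axioms of scalars with products change
    places. *)
HB.instance Definition _ := GRing.UnitRing.on A^c.
HB.instance Definition _ := GRing.LSemiModule.copy A^c A.
HB.instance Definition _ := Vector.copy A^c A.
HB.instance Definition _ := GRing.Lmodule_isLalgebra.Build K A^c
  (fun k x y => @scalerAr K A k y x).
HB.instance Definition _ := GRing.Lalgebra_isAlgebra.Build K A^c
  (fun k x y => @scalerAl K A k y x).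
End ConverseAlgebra.

Section KDual.
Variables (K : fieldType) (A : falgType K).
Implicit Types L M N X Y Z E : lmodType A.

Lemma kdualP X (y : kdual X) (k : K) x x' : y (k%:A *: x + x') = k * y x + y x'.
Proof. by have /asboolP := dual_funP y; apply. Qed.

Lemma kdual0 X (y : kdual X) : y 0 = 0.
Proof. by have := kdualP y (-1) 0 0; rewrite scaler0 addr0 mulN1r addNr. Qed.

Lemma kdualD X (y : kdual X) x x' : y (x + x') = y x + y x'.
Proof. by have := kdualP y 1 x x'; rewrite !scale1r mul1r. Qed.

Lemma kdualZ X (y : kdual X) (k : K) x : y (k%:A *: x) = k * y x.
Proof. by have := kdualP y k x 0; rewrite !addr0 kdual0 addr0. Qed.

Lemma kdualB X (y : kdual X) x x' : y (x - x') = y x - y x'.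
Proof.
have -> : - x' = (- 1)%:A *: x' by rewrite !scaleN1r.
by rewrite kdualD kdualZ mulN1r.
Qed.

Lemma kdual_sum X (y : kdual X) (I : finType) (x : I -> X) :
  y (\sum_i x i) = \sum_i y (x i).
Proof. exact: (big_morph y (kdualD y) (kdual0 y)). Qed.

Lemma kdual_scaleE X (a : A^c) (y : kdual X) x : (a *: y) x = y ((a : A) *: x).
Proof. by []. Qed.

Lemma kdual_addE X (y y' : kdual X) x : (y + y') x = y x + y' x.
Proof. by []. Qed.

Lemma kdual_sumE X (I : finType) (y : I -> kdual X) x : (\sum_i y i) x = \sum_i y i x.
Proof. exact: (big_morph (fun y : kdual X => y x) (fun _ _ => erefl) erefl). Qed.

Lemma kdual_ext X (y y' : kdual X) : (forall x, y x = y' x) -> y = y'.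
Proof. by move=> yy'; apply: val_inj; apply: funext. Qed.

Lemma mkdual X (y : X -> K) : (forall k x x', y (k%:A *: x + x') = k * y x + y x') ->
  exists z : kdual X, forall x, z x = y x.
Proof. by move=> yL; exists (Dual (asboolT yL)). Qed.

Lemma kdual_comp X Y (g : {linear X -> Y}) :
  exists h : {linear kdual Y -> kdual X}, forall y x, h y x = y (g x).
Proof.
apply: (@choose_linear _ (kdual Y) (kdual X) (fun y z => forall x, z x = y (g x))).
  by move=> y; apply: mkdual => k x x'; rewrite linearP kdualP.
move=> a y y' z z' t zE z'E tE; apply: kdual_ext => x.
by rewrite tE !kdual_addE !kdual_scaleE zE z'E linearZ.
Qed.

Lemma kdual_basis X : fin_gen X -> exists n (e : 'I_n -> X) (c : 'I_n -> kdual X),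
  forall x, x = \sum_i (c i x)%:A *: e i.
Proof.
move=> /kdimP; move: (kdim X) => n [c [cL [d cK dK]]].
have /choice[z zP] : forall i, exists z : kdual X, forall x, z x = c x 0 i.
  by move=> i; apply: mkdual => k x x'; rewrite cL !mxE.
exists n, (fun i => d (delta_mx 0 i)), z => x; apply: (can_inj cK).
have c0 : c 0 = 0.
  by have := cL (-1) 0 0; rewrite scaler0 addr0 scaleN1r addNr.
have cD u v : c (u + v) = c u + c v by have := cL 1 u v; rewrite !scale1r.
rewrite (big_morph c cD c0) [LHS]row_sum_delta; apply: eq_bigr => i _.
have := cL (c x 0 i) (d (delta_mx 0 i)) 0; rewrite !addr0 c0 addr0 dK => <-.
by rewrite zP.
Qed.

Lemma kdual_expand X n (e : 'I_n -> X) (c : 'I_n -> kdual X) (y : kdual X) :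
  (forall x, x = \sum_i (c i x)%:A *: e i) -> y = \sum_i ((y (e i))%:A : A^c) *: c i.
Proof.
move=> ecE; apply: kdual_ext => x; rewrite {1}[x]ecE kdual_sum kdual_sumE.
by apply: eq_bigr => i _; rewrite kdual_scaleE !kdualZ mulrC.
Qed.

Lemma kdual_fin_gen X : fin_gen X -> fin_gen (kdual X).
Proof.
move=> /kdual_basis[n [e [c ecE]]]; exists n, c => y; exists (fun i => (y (e i))%:A).
exact: kdual_expand.
Qed.

Lemma kdual_sep0 X x : fin_gen X -> (forall y : kdual X, y x = 0) -> x = 0.
Proof.
move=> /kdual_basis[n [e [c ecE]]] x0; rewrite [x]ecE big1 // => i _.
by rewrite x0 scale0r scale0r.
Qed.

(** Used to define maps into [X] by the functionals on D X that their values induce; uniqueness then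
    comes from [kdual_sep0]. *)
Lemma double_dual X (th : kdual X -> K) : fin_gen X ->
    (forall (k : K) (y y' : kdual X), th ((k%:A : A^c) *: y + y') = k * th y + th y') ->
  exists x, forall y, th y = y x.
Proof.
move=> /kdual_basis[n [e [c ecE]]] thL; exists (\sum_i (th (c i))%:A *: e i) => y.
have th0 : th 0 = 0 by have := thL (-1) 0 0; rewrite scaler0 addr0 mulN1r addNr.
have thD u v : th (u + v) = th u + th v by have := thL 1 u v; rewrite !scale1r mul1r.
rewrite {1}(kdual_expand y ecE) (big_morph th thD th0) kdual_sum.
apply: eq_bigr => i _; rewrite kdualZ mulrC.
by have := thL (y (e i)) (c i) 0; rewrite !addr0 th0 addr0.
Qed.

Lemma kdual_sep M (S : M -> Prop) w : fin_gen M ->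
    S 0 -> (forall (k : K) x y, S x -> S y -> S (k%:A *: x + y)) -> ~ S w ->
  exists lam : kdual M, (forall x, S x -> lam x = 0) /\ lam w <> 0.
Proof.
move=> /kdimP; move: (kdim M) => n [c [cL [d cK dK]]] S0 SL Sw.
have c0 : c 0 = 0.
  by have := cL (-1) 0 0; rewrite scaler0 addr0 scaleN1r addNr.
have dL k x y : d (k *: x + y) = k%:A *: d x + d y.
  by apply: (can_inj cK); rewrite cL !dK.
have [||G GP] := @subspace_mx K n (fun x => S (d x)).
- by rewrite -c0 cK.
- by move=> k x y Sx Sy; rewrite dL; apply: SL.
have : ~~ (c w <= G)%MS by apply/negP => /GP; rewrite cK.
(* [cokermx G] kills exactly the row space of [G], so a nonzero coordinate of the product gives the
   functional. *)
rewrite submxE => /rV0Pn[j jP].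
have [|lam lamE] := @mkdual M (fun x => (c x *m cokermx G) 0 j).
  by move=> k x y; rewrite cL mulmxDl -scalemxAl !mxE.
exists lam; split=> [x Sx|]; last by rewrite lamE; apply/eqP.
have : (c x <= G)%MS by apply/GP; rewrite cK.
by rewrite lamE submxE => /eqP->; rewrite mxE.
Qed.

Lemma fin_gen_power X n : fin_gen X -> fin_gen (dsum (fun _ : 'I_n => X)).
Proof.
move=> [m [v vP]]; exists #|{: 'I_n * 'I_m}|.
exists (fun l => dsum_inj (fun _ => X) (enum_val l).1 (v (enum_val l).2)) => u.
have /choice[a aP] : forall k : 'I_n, exists a : 'I_m -> A, u k = \sum_i a i *: v i.
  by move=> k; apply: vP.
exists (fun l => a (enum_val l).1 (enum_val l).2).
transitivity (\sum_(p : 'I_n * 'I_m) a p.1 p.2 *: dsum_inj (fun _ => X) p.1 (v p.2)).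
  rewrite -(pair_bigA _ (fun k i => a k i *: dsum_inj (fun _ => X) k (v i))) /=.
  rewrite -[LHS]dsum_sumE; apply: eq_bigr => k _.
  rewrite [dsum_proj _ _ _]aP linear_sum; apply: eq_bigr => i _.
  by rewrite linearZ.
by rewrite (reindex_onto enum_val enum_rank) => [|p _];
  [apply: eq_bigl => l; rewrite enum_valK eqxx | rewrite enum_rankK].
Qed.

(** Evaluation at finitely many elements embeds a Hom space into a power of [X]; subspaces of Hom
    are separated there. *)
Lemma kdual_dsum_sep X n (S : ('I_n -> X) -> Prop) (w : 'I_n -> X) : fin_gen X ->
    S (fun=> 0) ->
    (forall (k : K) s t, S s -> S t -> S (fun i => k%:A *: s i + t i)) -> ~ S w ->
  exists lam : 'I_n -> kdual X,
    (forall s, S s -> \sum_i lam i (s i) = 0) /\ \sum_i lam i (w i) <> 0.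
Proof.
move=> Xf S0 SL Sw; pose M := dsum (fun _ : 'I_n => X).
have [|||lam [lamS lamw]] :=
  @kdual_sep M (fun u : M => S u) (finfun w) (fin_gen_power n Xf).
- rewrite (_ : fun_of_fin _ = fun=> 0) //.
  by apply: funext => i; rewrite ffunE.
- move=> k s t Ss St; rewrite (_ : fun_of_fin _ = fun i => k%:A *: s i + t i);
  first exact: SL.
  by apply: funext => i; rewrite !ffunE.
- by rewrite (_ : fun_of_fin _ = w) //; apply: funext => i; rewrite ffunE.
have /choice[h hP] : forall i, exists z :
  kdual X, forall x, z x = lam (dsum_inj (fun _ => X) i x).
  by move=> i; apply: mkdual => k x x'; rewrite linearP kdualP.
have E u : lam (finfun u) = \sum_i h i (u i).
  rewrite -[finfun u]dsum_sumE kdual_sum; apply: eq_bigr => i _.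
  by rewrite hP /= ffunE.
exists h; rewrite -E; split=> // s Ss; rewrite -E; apply: lamS.
by rewrite (_ : fun_of_fin _ = s) //; apply: funext => i; rewrite ffunE.
Qed.
End KDual.

(** * The dual Hom_A(P, A) of a projective right module *)

Section RegularDual.
Variables (K : fieldType) (A : falgType K).
Implicit Types (P Q : lmodType A^c) (L M X Y : lmodType A).

(* [regular_dual P] is the left module P* = Hom_A(P, A); [ev phi x] is phi(x). *)
Definition ev P (phi : regular_dual P) (x : P) : A := \val phi x.

Lemma evP P (phi : regular_dual P) (a : A^c) x y :
  ev phi (a *: x + y) = ev phi x * (a : A) + ev phi y.
Proof. by have /asboolP := valP phi; apply. Qed.

Lemma ev0 P (phi : regular_dual P) : ev phi 0 = 0.
Proof. by have := evP phi (-1) 0 0; rewrite scaler0 addr0 mulrN1 addNr. Qed.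

Lemma evD P (phi : regular_dual P) x y : ev phi (x + y) = ev phi x + ev phi y.
Proof. by have := evP phi 1 x y; rewrite !scale1r mulr1. Qed.

Lemma evZ P (phi : regular_dual P) (a : A^c) x : ev phi (a *: x) = ev phi x * (a : A).
Proof. by have := evP phi a x 0; rewrite !addr0 ev0 addr0. Qed.

Lemma ev_sum P (phi : regular_dual P) (I : finType) (x : I -> P) :
  ev phi (\sum_i x i) = \sum_i ev phi (x i).
Proof. exact: (big_morph (ev phi) (evD phi) (ev0 phi)). Qed.

Lemma ev_ext P (phi psi : regular_dual P) : (forall x, ev phi x = ev psi x) ->
    phi = psi.
Proof. by move=> E; apply: val_inj; apply: funext. Qed.

Lemma evE P (b : A) (phi psi : regular_dual P) x :
  ev (b *: phi + psi) x = b * ev phi x + ev psi x.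
Proof. by []. Qed.

Lemma ev_scaleE P (b : A) (phi : regular_dual P) x : ev (b *: phi) x = b * ev phi x.
Proof. by []. Qed.

Lemma ev_subE P (phi psi : regular_dual P) x : ev (phi - psi) x = ev phi x - ev psi x.
Proof. by []. Qed.

Lemma evB P (phi : regular_dual P) x y : ev phi (x - y) = ev phi x - ev phi y.
Proof. by rewrite -scaleN1r addrC evP mulrN1 addrC. Qed.

Lemma ev_sumE P (I : finType) (phi : I -> regular_dual P) x :
  ev (\sum_i phi i) x = \sum_i ev (phi i) x.
Proof. exact: (big_morph (fun phi :
  regular_dual P => ev phi x) (fun _ _ => erefl) erefl). Qed.

Lemma mkregular P (g : P -> A) : (forall (a : A^c) x y, g (a *: x + y) = g x * (a :
    A) + g y) ->
  exists phi : regular_dual P, forall x, ev phi x = g x.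
Proof.
move=> gL; have gP : (g : P -> A^o) \in (@hom_pred K A P : submodClosed (P ->
  A^o)) by exact: asboolT.
by exists (Submod gP).
Qed.

Fact rdual_subproof P Q (t : {linear Q -> P}) :
  exists h : {linear regular_dual P ->
    regular_dual Q}, forall phi x, ev (h phi) x = ev phi (t x).
Proof.
apply: (@choose_linear _ (regular_dual P) (regular_dual Q)
  (fun phi psi => forall x, ev psi x = ev phi (t x))).
  by move=> phi; apply: mkregular => a x y; rewrite linearP evP.
move=> a u u' v v' w vE v'E wE; apply: ev_ext => x.
by rewrite wE !evE vE v'E.
Qed.
Definition rdual P Q (t : {linear Q -> P}) := projT1 (cid (rdual_subproof t)).
Lemma rdualE P Q (t : {linear Q -> P}) phi x : ev (rdual t phi) x = ev phi (t x).
Proof. by rewrite /rdual; case: (cid _). Qed.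

Definition dual_basis P n (q : 'I_n -> P) (phi : 'I_n -> regular_dual P) :=
  forall x, x = \sum_i (ev (phi i) x : A^c) *: q i.

Lemma dual_basis_exists P : fin_gen P -> projective P ->
  exists n q phi, @dual_basis P n q phi.
Proof.
move=> Pf Pp; have [n [i [r rK]]] := projective_retract_free Pf Pp.
have /choice[phi phiP] : forall k, exists phi :
  regular_dual P, forall x, ev phi x = i x k.
  move=> k; apply: mkregular => a x y; rewrite linearP.
  by rewrite ffunE ffunE.
exists n, (fun k => r (@free_basis K _ n k)), phi => x.
rewrite -[LHS]rK {1}[i x]free_basisE linear_sum; apply: eq_bigr => k _.
by rewrite linearZ /= phiP.
Qed.

Lemma dual_basis_expand P n q phi (psi : regular_dual P) :
  @dual_basis P n q phi -> psi = \sum_i ev psi (q i) *: phi i.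
Proof.
move=> qphi; apply: ev_ext => x; rewrite {1}[x]qphi ev_sum ev_sumE.
by apply: eq_bigr => i _; rewrite evZ ev_scaleE.
Qed.

Lemma regular_dual_fin_gen P : fin_gen P -> projective P -> fin_gen (regular_dual P).
Proof.
move=> Pf Pp; have [n [q [phi qphi]]] := dual_basis_exists Pf Pp.
exists n, phi => psi; exists (fun i => ev psi (q i)); exact: dual_basis_expand.
Qed.

(** The map given by the tensor sum of the q_i (x) y_i under P (x) Y -> Hom(P^*, Y). *)
Lemma regular_dual_map P Y n (q : 'I_n -> P) (y : 'I_n -> Y) :
  exists h : {linear regular_dual P ->
    Y}, forall psi, h psi = \sum_i ev psi (q i) *: y i.
Proof.
have hL (a : A) (u v : regular_dual P) : \sum_i ev (a *: u + v) (q i) *: y i =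
    a *: \sum_i ev u (q i) *: y i + \sum_i ev v (q i) *: y i.
  rewrite scaler_sumr -big_split; apply: eq_bigr => i _ /=.
  by rewrite evE scalerDl scalerA.
by exists (mklin hL).
Qed.

Lemma regular_dual_projective P : fin_gen P -> projective P ->
    projective (regular_dual P).
Proof.
move=> Pf Pp X Y g h gS; have [n [q [phi qphi]]] := dual_basis_exists Pf Pp.
have /choice[y yP] : forall i, exists x, g x = h (phi i) by move=> i; apply: gS.
have [k kE] := regular_dual_map q y; exists k => psi.
rewrite {1}(dual_basis_expand psi qphi) kE !linear_sum; apply: eq_bigr => i _.
by rewrite !linearZ /= yP.
Qed.

(** The transpose is forced: phi_i (t x) has to be (b phi_i)(x), and the dual basis rebuilds [t x]
    from these coordinates. *)
Lemma regular_dual_transpose P Q (b : {linear regular_dual P -> regular_dual Q}) :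
    fin_gen P -> projective P ->
  exists t : {linear Q -> P}, forall phi, b phi = rdual t phi.
Proof.
move=> Pf Pp; have [n [q [phi qphi]]] := dual_basis_exists Pf Pp.
have tL (a : A^c) (x y : Q) : \sum_i (ev (b (phi i)) (a *: x + y) : A^c) *: q i =
    a *: \sum_i (ev (b (phi i)) x : A^c) *: q i + \sum_i (ev (b (phi i)) y :
      A^c) *: q i.
  rewrite scaler_sumr -big_split; apply: eq_bigr => i _ /=.
  by rewrite evP scalerA -scalerDl.
exists (mklin tL) => psi; apply: ev_ext => x; rewrite rdualE /= ev_sum.
rewrite {1}(dual_basis_expand psi qphi) linear_sum ev_sumE; apply: eq_bigr => i _.
by rewrite linearZ ev_scaleE evZ.
Qed.

Lemma ev_sep P x y : fin_gen P -> projective P ->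
  (forall phi : regular_dual P, ev phi x = ev phi y) -> x = y.
Proof.
move=> Pf Pp E; have [n [q [phi qphi]]] := dual_basis_exists Pf Pp.
by rewrite [x]qphi [RHS]qphi; apply: eq_bigr => i _; rewrite E.
Qed.
End RegularDual.

(** * The defect formula *)

Section QuotientModule.
Variables (R : pzRingType) (M : lmodType R) (U : submodClosed M).

Definition qpred : {pred M} := [pred x | x \in U].
Fact qpred_zmod_closed : zmod_closed qpred.
Proof.
split=> [|x y Ux Uy]; first exact: rpred0.
exact: submodB.
Qed.
HB.instance Definition _ := GRing.isZmodClosed.Build M qpred qpred_zmod_closed.

Definition qmod : Type := Quotient.quot qpred.
HB.instance Definition _ := GRing.Zmodule.on qmod.
Definition qproj (x : M) : qmod := (\pi_(Quotient.quot qpred) x)%qT.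
Definition qscale (a : R) (x : qmod) : qmod := qproj (a *: generic_quotient.repr x).

Lemma qprojE x y : qproj x = qproj y <-> x - y \in U.
Proof.
have -> : (x - y \in U) = (x - y \in qpred) by [].
by rewrite Quotient.idealrBE; split=> [xy|/eqP//]; apply/eqP.
Qed.

Lemma qprojD x y : qproj (x + y) = qproj x + qproj y.
Proof. exact: Quotient.pi_add. Qed.

Lemma qprojP x : exists y, qproj y = x.
Proof. by exists (generic_quotient.repr x); apply: reprK. Qed.

Lemma qscaleE a x : qscale a (qproj x) = qproj (a *: x).
Proof. by apply/qprojE; rewrite -scalerBr rpredZ //; apply/qprojE; apply: reprK. Qed.

Fact qscaleA a b x : qscale a (qscale b x) = qscale (a * b) x.
Proof. by have [y <-] := qprojP x; rewrite !qscaleE scalerA. Qed.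
Fact qscale1 : left_id 1 qscale.
Proof. by move=> x; have [y <-] := qprojP x; rewrite !qscaleE scale1r. Qed.
Fact qscaleDr : right_distributive qscale +%R.
Proof.
move=> a x y; have [u <-] := qprojP x; have [v <-] := qprojP y.
by rewrite -qprojD !qscaleE scalerDr qprojD.
Qed.
Fact qscaleDl x : {morph qscale^~ x : a b / a + b}.
Proof. by move=> a b; have [u <-] := qprojP x; rewrite !qscaleE scalerDl qprojD. Qed.

HB.instance Definition _ := GRing.Zmodule_isLmodule.Build R qmod
  qscaleA qscale1 qscaleDr qscaleDl.

Lemma quotient_exists : exists (T : lmodType R) (c : {linear M -> T}),
  surjective c /\ forall x, c x = 0 <-> x \in U.
Proof.
have cL a x y : qproj (a *: x + y) = a *: qproj x + qproj y by rewrite qprojD -qscaleE.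
exists qmod, (mklin cL); split=> [x|x] /=; first exact: qprojP.
have q0 : qproj 0 = 0 by apply: (addrI (qproj 0)); rewrite -qprojD !addr0.
by rewrite -q0; rewrite qprojE subr0.
Qed.
End QuotientModule.

Section Presentation.
Variables (K : fieldType) (A : falgType K).
Implicit Types (P Q : lmodType A^c) (L M N E T W X Y Z : lmodType A).

(** Since [k%:A] is central in [A], scaling by it preserves [A]-linearity; this is the [K]-structure
    of Hom(M, N). *)
Lemma lin_comb M N (k : K) (v v' : {linear M -> N}) :
  exists w : {linear M -> N}, forall x, w x = k%:A *: v x + v' x.
Proof.
have wL a x y : k%:A *: v (a *: x + y) + v' (a *: x + y) =
    a *: (k%:A *: v x + v' x) + (k%:A *: v y + v' y).
  have ka : k%:A * a = a * k%:A by rewrite -scalerAl mul1r -scalerAr mulr1.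
  rewrite !linearP !scalerDr !scalerA ka; exact: addrACA.
by exists (mklin wL).
Qed.

(* [pr_ess0] and [pr_ess1] express that both terms of the presentation are
   projective covers. *)
Record presented X T P1 P0 (d : {linear P1 -> P0}) (p : {linear P0 -> kdual X})
    (c : {linear regular_dual P1 -> T}) : Prop := Presented {
  pr_fg1 : fin_gen P1;
  pr_fg0 : fin_gen P0;
  pr_proj1 : projective P1;
  pr_proj0 : projective P0;
  pr_surj : surjective p;
  pr_exact : forall x, p x = 0 <-> exists y, d y = x;
  pr_ess0 : forall Q (g : {linear Q -> P0}), surjective (p \o g) -> surjective g;
  pr_ess1 : forall Q (g : {linear Q -> P1}),
    (forall x, p x = 0 -> exists z, d (g z) = x) -> surjective g;
  pr_csurj : surjective c;
  pr_cker : forall phi, c phi = 0 <-> exists psi, phi = rdual d psi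
}.

Lemma tau_inv_presented X T : tau_inv X T ->
  exists P1 P0 d p c, @presented X T P1 P0 d p c.
Proof.
move=> [P1 [P0 [d [p [c [[[P0f P0p [pS p0]] [d' [P1f P1p [d'S d'0]] dE]] cS cK]]]]]].
exists P1, P0, d, p, c; split=> //.
- move=> x; split=> [px|[y <-]].
    have xk : x \in mod_ker p by rewrite inE px.
    by have [y yE] := d'S (Submod xk); exists y; rewrite dE yE.
  by rewrite dE; have /eqP := valP (d' y).
- move=> Q g gS; apply: (d'0 Q) => -[x xk]; have px : p x = 0 by apply/eqP.
  by have [z zE] := gS x px; exists z; apply: val_inj; rewrite /= -dE.
- move=> phi; rewrite cK; split=> [[psi psiE]|[psi ->]]; exists psi.
    by apply: ev_ext => x; rewrite rdualE; apply: psiE.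
  by move=> x; apply: rdualE.
Qed.

Lemma tau_inv_exists X : fin_gen X -> exists T, tau_inv X T.
Proof.
move=> Xf; have [P0 [p pc]] := projective_cover_exists (kdual_fin_gen Xf).
have P0f : fin_gen P0 by case: pc.
have kf : fin_gen (submod (mod_ker p)).
  by apply: (fin_gen_inj (g := \val)) P0f _; apply: val_inj.
have [P1 [d' dc]] := projective_cover_exists kf.
have [T [c [cS cK]]] := quotient_exists (mod_im (rdual (\val \o d'))).
exists T, P1, P0, (\val \o d'), p, c; split=> //.
  by split=> //; exists d'.
move=> phi; rewrite cK; split=> [/mod_imP[psi <-]|[psi psiE]].
  by exists psi => x; apply: rdualE.
by apply/mod_imP; exists psi; apply: ev_ext => x; rewrite rdualE; apply/esym/psiE.
Qed.

Lemma presented_fin_gen X T P1 P0 d p c : @presented X T P1 P0 d p c -> fin_gen T.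
Proof.
move=> H; apply: fin_gen_surj (pr_csurj H).
by apply: regular_dual_fin_gen; [apply: pr_fg1 H | apply: pr_proj1 H].
Qed.

(* The image of [g] under the natural map
   [Hom_A(P0*, L) = P0 (x) L -> D Hom_A(L, X)] induced by [p]. *)
Definition pairing P0 n (q : 'I_n -> P0) (phi : 'I_n -> regular_dual P0) X
    (p : {linear P0 -> kdual X}) L (g : {linear regular_dual P0 -> L})
    (v : {linear L -> X}) : K :=
  \sum_i p (q i) (v (g (phi i))).

(** The hypothesis on [g] says that it is the tensor sum of the z_j (x) l_j. The pairing may thus be
    computed from any such expression, not only from the dual basis. *)
Lemma pairingE P0 n q phi X p L (g : {linear regular_dual P0 -> L})
    (v : {linear L -> X}) (I : finType) (z : I -> P0) (l : I -> L) :
    @dual_basis _ _ P0 n q phi ->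
    (forall i, g (phi i) = \sum_j ev (phi i) (z j) *: l j) ->
  @pairing P0 n q phi X p L g v = \sum_j p (z j) (v (l j)).
Proof.
move=> qphi gE; rewrite /pairing.
transitivity (\sum_i \sum_j p (q i) (v (ev (phi i) (z j) *: l j))).
  by apply: eq_bigr => i _; rewrite gE linear_sum kdual_sum.
rewrite exchange_big; apply: eq_bigr => j _.
rewrite [z j in RHS]qphi linear_sum kdual_sumE; apply: eq_bigr => i _.
by rewrite !linearZ kdual_scaleE.
Qed.

(** Values at a spanning family [e] embed Hom(L, X) into a power of [X]. A separating functional has
    components in D X; lifting them along [p] to [z i] gives [g] as the sum of the z_i (x) e_i. *)
Lemma pairing_sep P0 n q phi X (p : {linear P0 -> kdual X}) L
    (S : {linear L -> X} -> Prop) (u : {linear L -> X}) :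
    @dual_basis _ _ P0 n q phi -> fin_gen L -> fin_gen X -> surjective p ->
    (forall v : {linear L -> X}, (forall x, v x = 0) -> S v) ->
    (forall (k : K) (v1 v2 v : {linear L -> X}), S v1 -> S v2 ->
       (forall x, v x = k%:A *: v1 x + v2 x) -> S v) -> ~ S u ->
  exists g : {linear regular_dual P0 -> L},
    (forall v, S v -> pairing q phi p g v = 0) /\ pairing q phi p g u <> 0.
Proof.
move=> qphi Lf Xf pS S0 SL Su; have [r [e [cL ecE]]] := kdual_basis Lf.
pose S' (s : 'I_r -> X) := exists2 v, S v & forall i, s i = v (e i).
have [|||lam [lamS lamu]] := @kdual_dsum_sep _ _ X r S' (u \o e) Xf.
- by exists \0 => //; apply: S0.
- move=> k s t [v Sv vE] [v' Sv' v'E]; have [w wE] := lin_comb k v v'.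
  by exists w => [|i]; [apply: SL Sv Sv' wE | rewrite wE vE v'E].
(* Writing [u] as 1 times [v] plus 0 carries [S] over to the pointwise equal map. *)
- move=> [v Sv vE]; apply: Su; apply: (SL 1 v \0) => // [|x]; first by apply: S0.
  rewrite scale1r scale1r addr0 [x]ecE !linear_sum; apply: eq_bigr => i _.
  by rewrite !linearZ -vE.
have /choice[z zP] : forall i, exists z, p z = lam i by move=> i; apply: pS.
have [g gE] := regular_dual_map z e; exists g.
have E v : pairing q phi p g v = \sum_j lam j (v (e j)).
  by rewrite (pairingE p v qphi (fun i => gE (phi i))); apply: eq_bigr => j _;
    rewrite zP.
by rewrite E; split=> // v Sv; rewrite E; apply: lamS; exists v.
Qed.

Section Presented.
Variables (X T : lmodType A) (P1 P0 : lmodType A^c) (d : {linear P1 -> P0})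
  (p : {linear P0 -> kdual X}) (c : {linear regular_dual P1 -> T}).
Hypotheses (H : presented d p c) (Xf : fin_gen X).
Variables (n : nat) (q : 'I_n -> P0) (phi : 'I_n -> regular_dual P0).
Hypothesis qphi : dual_basis q phi.

(** Here [g] is a sum of tensors d(r_j) (x) k(psi_j), and [p] vanishes on the image of [d]. *)
Lemma pairing_rdual L (k : {linear regular_dual P1 ->
    L}) (g : {linear regular_dual P0 -> L})
    (v : {linear L -> X}) :
  (forall psi, g psi = k (rdual d psi)) -> pairing q phi p g v = 0.
Proof.
move=> gE; have [m [r [psi rpsi]]] := dual_basis_exists (pr_fg1 H) (pr_proj1 H).
rewrite (pairingE (z := fun j => d (r j)) (l := fun j => k (psi j)) p v qphi).
  rewrite big1 // => j _; rewrite (_ : p _ = 0) //.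
  by apply/(pr_exact H); exists (r j).
move=> i; rewrite gE {1}(dual_basis_expand (rdual d (phi i)) rpsi) linear_sum.
by apply: eq_bigr => j _; rewrite linearZ rdualE.
Qed.

(* If w : P0* -> E does not factor through d* : P0* -> P1*, a K-functional on
   Hom(P0*, E) that kills the maps factoring through d* is given by a map
   E -> D P0 whose composite with D d vanishes, i.e. by a map v : E -> X. *)
Lemma pairing_factor E (w : {linear regular_dual P0 -> E}) : fin_gen E ->
    (forall v, pairing q phi p w v = 0) ->
  exists k : {linear regular_dual P1 -> E}, forall psi, w psi = k (rdual d psi).
Proof.
move=> Ef w0; apply: contrapT => wk.
pose S (s : 'I_n -> E) := exists k : {linear regular_dual P1 -> E},
  forall i, s i = k (rdual d (phi i)).
have [|||lam [lamS lamw]] := @kdual_dsum_sep _ _ E n S (w \o phi) Ef.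
- by exists \0.
- move=> k s t [v vE] [v' v'E]; have [z zE] := lin_comb k v v'.
  by exists z => i; rewrite zE vE v'E.
- move=> [k kE]; apply: wk; exists k => psi.
  rewrite [psi](dual_basis_expand psi qphi) !linear_sum; apply: eq_bigr => i _.
  by rewrite !linearZ -kE.
(* The value of the functional on the map psi |-> psi(x) e. It will vanish for [x] in the image of
   [d], where that map factors through d^*; hence [h e] lives on D X and is evaluation at an element
   [v e] of [X]. *)
pose h (e : E) (x : P0) := \sum_i lam i (ev (phi i) x *: e).
have hD e x y : h e (x + y) = h e x + h e y.
  rewrite /h -big_split; apply: eq_bigr => i _ /=.
  by rewrite evD scalerDl kdualD.
have hk (k : K) e x : h e ((k%:A : A^c) *: x) = k * h e x.
  rewrite /h mulr_sumr; apply: eq_bigr => i _.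
  have ka (a : A) : a * k%:A = k%:A * a by rewrite -scalerAl mul1r -scalerAr mulr1.
  by rewrite evZ ka -scalerA kdualZ.
have hd e y : h e (d y) = 0.
  have [k kE] := @regular_dual_map _ _ P1 E 1 (fun=> y) (fun=> e).
  rewrite -(lamS (fun i => k (rdual d (phi i)))); last by exists k.
  by apply: eq_bigr => i _; rewrite kE big_ord1 rdualE.
have hp e x y : p x = p y -> h e x = h e y.
  move=> xy; have /(pr_exact H)[z zE] : p (x - y) = 0 by rewrite linearB xy subrr.
  by rewrite -(subrK y x) -zE hD hd add0r.
have hL (a : A) e e' x : h (a *: e + e') x = h e ((a : A^c) *: x) + h e' x.
  rewrite /h -big_split; apply: eq_bigr => i _ /=.
  by rewrite scalerDr kdualD evZ scalerA.
have /choice[sec secP] := pr_surj H.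
have [||v vP] := @choose_linear _ E X (fun e z => forall x, p x z = h e x).
- move=> e; have [k y y'|z zP] := @double_dual _ _ X (fun y => h e (sec y)) Xf.
    rewrite -hk -hD; apply: hp.
    by rewrite linearD linearZ !secP.
  by exists z => x; rewrite -zP; apply: hp; rewrite secP.
- move=> a e e' z z' t zE z'E tE; apply/eqP; rewrite -subr_eq0; apply/eqP.
  apply: (kdual_sep0 Xf) => y; have [x <-] := pr_surj H y.
  rewrite kdualB kdualD tE.
  have -> : p x (a *: z) = p ((a : A^c) *: x) z by rewrite linearZ.
  by rewrite zE z'E hL subrr.
(* The functional at [w] equals the pairing of [w] with this [v], which is 0. *)
apply: lamw; rewrite -[RHS](w0 v) /pairing.
transitivity (\sum_k \sum_i lam i (ev (phi i) (q k) *: w (phi k))).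
  rewrite exchange_big; apply: eq_bigr => i _ /=.
  rewrite {1}(dual_basis_expand (phi i) qphi) linear_sum kdual_sum.
  by apply: eq_bigr => k _; rewrite linearZ.
by apply: eq_bigr => k _; rewrite vP.
Qed.
End Presented.

(* g and h are related as by the connecting homomorphism of the snake lemma
   applied to Hom(T, -) -> Hom(P1*, -) -> Hom(P0*, -) -> D Hom(-, X). *)
Lemma connecting_lift X T P1 P0 d p c n q phi L E W (i : {linear L -> E})
    (pi : {linear E -> W}) (g : {linear regular_dual P0 -> L})
    (k : {linear regular_dual P1 -> E}) (h : {linear T -> W}) :
    @presented X T P1 P0 d p c -> @dual_basis _ _ P0 n q phi -> injective i ->
    (forall x, pi x = 0 <-> exists y, i y = x) ->
    (forall psi, i (g psi) = k (rdual d psi)) -> (forall psi, h (c psi) = pi (k psi)) ->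
    factors_through pi h ->
  forall v : {linear L -> X}, pairing q phi p g v = 0.
Proof.
move=> H qphi iI ex kE hE [h' h'E] v.
(* Subtracting the lift of [h] moves [k] into [L]; as [c] kills the image of d^*, this does not
   change its composite with d^*. *)
have [psi|k' k'E] := @factor_inj _ L E _ i (k \- (h' \o c)) iI.
  by apply/ex; rewrite /= linearB -h'E hE /= subrr.
apply: (pairing_rdual H qphi (k := k')) => psi; apply: iI.
have c0 : c (rdual d psi) = 0 by apply/(pr_cker H); exists psi.
by rewrite k'E kE /= c0 linear0 oppr0 addr0.
Qed.

(** [i \o g] pairs to 0 with Hom(E, X), hence extends along d^* to [k]; [pi \o k] kills the image of
    d^* and descends to [T]. *)
Lemma connecting_exists X T P1 P0 d p c n q phi L E W (i : {linear L -> E})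
    (pi : {linear E -> W}) (g : {linear regular_dual P0 -> L}) :
    @presented X T P1 P0 d p c -> @dual_basis _ _ P0 n q phi -> fin_gen X ->
      fin_gen E ->
    (forall x, pi x = 0 <-> exists y, i y = x) ->
    (forall v : {linear E -> X}, pairing q phi p g (v \o i) = 0) ->
  exists (k : {linear regular_dual P1 -> E}) (h : {linear T -> W}),
    (forall psi, i (g psi) = k (rdual d psi)) /\ (forall psi, h (c psi) = pi (k psi)).
Proof.
move=> H qphi Xf Ef ex g0.
have [|k kE] := pairing_factor H Xf qphi (w := i \o g) Ef; first exact: g0.
have [psi|h hE] := factor_surj (k := pi \o k) (pr_csurj H); last by exists k, h.
by move=> /(pr_cker H)[chi ->]; rewrite /= -kE; apply/ex; exists (g chi).
Qed.

(* Otherwise some functional on Hom(L, X) kills the maps that extend to E but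
   not u; it is the pairing with a g : P0* -> L, and the map T -> W connected
   to g does not lift to E. *)
Lemma tau_inv_lift X T L E W (i : {linear L -> E}) (pi : {linear E ->
    W}) (u : {linear L -> X}) :
    tau_inv X T -> fin_gen X -> fin_gen E -> injective i ->
    (forall x, pi x = 0 <-> exists y, i y = x) ->
    (forall phi : {linear T -> W}, factors_through pi phi) ->
  exists v : {linear E -> X}, forall x, v (i x) = u x.
Proof.
move=> /tau_inv_presented[P1 [P0 [d [p [c H]]]]] Xf Ef iI ex lift.
apply: contrapT => ext; have Lf : fin_gen L by apply: fin_gen_inj Ef iI.
have [n [q [phi qphi]]] := dual_basis_exists (pr_fg0 H) (pr_proj0 H).
pose S (v : {linear L -> X}) := exists v' : {linear E -> X}, forall x, v' (i x) = v x.
have [||g [gS gu]] := @pairing_sep P0 n q phi X p L S u qphi Lf Xf (pr_surj H) _ _ ext.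
- by move=> v v0; exists \0 => x; rewrite v0.
- move=> k v1 v2 v [w1 w1E] [w2 w2E] vE; have [w wE] := lin_comb k w1 w2.
  by exists w => x; rewrite wE w1E w2E vE.
have [v|k [h [kE hE]]] := connecting_exists (i := i) H qphi Xf Ef ex (g := g).
  by apply: gS; exists v.
by apply: gu; apply: connecting_lift H qphi iI ex kE hE (lift h) u.
Qed.
End Presentation.

(** * Morphisms between inverse translates *)

Section Transport.
Variables (K : fieldType) (A : falgType K).
Implicit Types (P Q : lmodType A^c) (L M N E T U V W X Y Z : lmodType A).

Lemma projective_lift_im (R : pzRingType) (P M N : lmodType R)
    (g : {linear M -> N}) (h : {linear P -> N}) :
  projective P -> (forall x, exists y, g y = h x) ->
  exists h' : {linear P -> M}, forall x, g (h' x) = h x.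
Proof.
move=> Pp gh; have [x|g' g'E] := @corestrict _ _ (mod_im g) M g.
  by apply/mod_imP; exists x.
have [x|h1 h1E] := @corestrict _ _ (mod_im g) P h; first exact/mod_imP.
have [|h' h'E] := Pp _ _ g' h1.
  case=> y yP; have /mod_imP[x xE] := yP; exists x; apply: val_inj.
  by rewrite g'E.
by exists h' => x; rewrite -h1E h'E g'E.
Qed.

(* [b : U -> T] and [beta : Y -> X] correspond to each other under tau^-1,
   where T = tau^-1 X and U = tau^-1 Y. *)
Definition transports X T P1 P0 (d : {linear P1 -> P0}) (p : {linear P0 -> kdual X})
    (c : {linear regular_dual P1 -> T}) Y U Q1 Q0 (d' : {linear Q1 -> Q0})
    (p' : {linear Q0 -> kdual Y}) (c' : {linear regular_dual Q1 -> U})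
    (b : {linear U -> T}) (beta : {linear Y -> X}) :=
  exists (t0 : {linear P0 -> Q0}) (t1 : {linear P1 -> Q1}),
    [/\ forall x y, p' (t0 x) y = p x (beta y),
        forall x, d' (t1 x) = t0 (d x)
      & forall psi, b (c' psi) = c (rdual t1 psi)].

Section Pair.
Variables (X T : lmodType A) (P1 P0 : lmodType A^c) (d : {linear P1 -> P0})
  (p : {linear P0 -> kdual X}) (c : {linear regular_dual P1 -> T}).
Variables (Y U : lmodType A) (Q1 Q0 : lmodType A^c) (d' : {linear Q1 -> Q0})
  (p' : {linear Q0 -> kdual Y}) (c' : {linear regular_dual Q1 -> U}).
Hypotheses (H : presented d p c) (H' : presented d' p' c').

Lemma rdual_commute (t0 : {linear P0 -> Q0}) (t1 : {linear P1 -> Q1}) psi :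
  (forall x, d' (t1 x) = t0 (d x)) ->
  rdual t1 (rdual d' psi) = rdual d (rdual t0 psi).
Proof. by move=> dt; apply: ev_ext => x; rewrite !rdualE dt. Qed.

(** Lift [b] to the projectives Q1^* -> P1^* and Q0^* -> P0^* and transpose. The resulting map of
    presentations induces D X -> D Y, whose [K]-dual is [beta]. *)
Lemma transports_of_tau (b : {linear U -> T}) : fin_gen X ->
  exists beta, transports d p c d' p' c' b beta.
Proof.
move=> Xf.
have Q1p := regular_dual_projective (pr_fg1 H') (pr_proj1 H').
have Q0p := regular_dual_projective (pr_fg0 H') (pr_proj0 H').
have [b1 b1E] := Q1p _ _ c (b \o c') (pr_csurj H).
have [|b0 b0E] := projective_lift_im (g := rdual d) (h := b1 \o rdual d') Q0p.
  move=> psi; have /(pr_cker H)[chi chiE] : c (b1 (rdual d' psi)) = 0.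
    rewrite -b1E /= (_ : c' _ = 0) ?linear0 //.
    by apply/(pr_cker H'); exists psi.
  by exists chi; rewrite -chiE.
have [t1 t1E] := regular_dual_transpose b1 (pr_fg1 H') (pr_proj1 H').
have [t0 t0E] := regular_dual_transpose b0 (pr_fg0 H') (pr_proj0 H').
have dt x : d' (t1 x) = t0 (d x).
  apply: (ev_sep (pr_fg0 H') (pr_proj0 H')) => psi.
  by rewrite -[LHS]rdualE -[LHS]rdualE -t1E -[b1 _]b0E t0E !rdualE.
have [x|be beE] := factor_surj (k := p' \o t0) (pr_surj H).
  move=> /(pr_exact H)[y <-]; rewrite /= -dt.
  by apply/(pr_exact H'); exists (t1 y).
have [||beta betaP] := @choose_linear _ Y X (fun y z => forall del :
  kdual X, be del y = del z).
- move=> y; apply: (@double_dual _ _ X (fun del => be del y) Xf) => k u v.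
  by rewrite linearP kdual_addE kdual_scaleE kdualZ.
- move=> a y y' z z' w zE z'E wE; apply/eqP; rewrite -subr_eq0; apply/eqP.
  apply: (kdual_sep0 Xf) => del.
  rewrite kdualB kdualD -wE -z'E kdualD.
  have -> : del (a *: z) = ((a : A^c) *: del) z by [].
  by rewrite -zE linearZ kdual_scaleE subrr.
exists beta, t0, t1; split=> // [x y|psi]; first by rewrite -betaP beE.
by rewrite -t1E -b1E.
Qed.

Lemma transports_of_map (beta : {linear Y -> X}) :
  exists b, transports d p c d' p' c' b beta.
Proof.
have [be beE] := kdual_comp beta.
have [t0 t0E] := pr_proj0 H (be \o p) (pr_surj H').
have [|t1 t1E] := projective_lift_im (g := d') (h := t0 \o d) (pr_proj1 H).
  move=> x; apply/(pr_exact H'); rewrite -t0E /= (_ : p _ = 0) ?linear0 //.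
  by apply/(pr_exact H); exists x.
have [psi|b bE] := factor_surj (k := c \o rdual t1) (pr_csurj H').
  move=> /(pr_cker H')[chi ->]; apply/(pr_cker H).
  by exists (rdual t0 chi); apply: rdual_commute.
by exists b, t0, t1; split=> // x y; rewrite -t0E /= beE.
Qed.
End Pair.

(* A section s of beta gives s0, s1 such that s0 t0 and s1 t1 are onto, hence
   bijective, by minimality of the presentation of D X. *)
Lemma transports_split_epi X T P1 P0 d p c Y U Q1 Q0 d' p' c' b beta :
    @presented _ A X T P1 P0 d p c -> @presented _ A Y U Q1 Q0 d' p' c' ->
    transports d p c d' p' c' b beta -> split_epi beta ->
  split_epi b.
Proof.
move=> H H' [t0 [t1 [t0E t1E bE]]] [s sK].
have [sig [s0 [s1 [s0E s1E sigE]]]] := transports_of_map H' H s.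
have ps x : p (s0 (t0 x)) = p x.
  by apply: kdual_ext => y; rewrite s0E t0E sK.
have S0 : surjective (s0 \o t0).
  apply: (pr_ess0 H) => y; have [x <-] := pr_surj H y.
  by exists x; rewrite /= ps.
have S1 : surjective (s1 \o t1).
  apply: (pr_ess1 H) => z pz; have [z' /= z'E] := S0 z.
  have /(pr_exact H)[y yE] : p z' = 0 by rewrite -ps z'E.
  by exists y; rewrite /= s1E t1E yE.
have [r [rK Kr]] := linear_inv (surj_endo_bij (pr_fg1 H) S1).
have bS : surjective (b \o sig).
  move=> y; have [phi <-] := pr_csurj H y.
  exists (c (rdual r phi)); rewrite /= sigE bE; congr (c _); apply: ev_ext => x.
  by rewrite !rdualE -[s1 _]/((s1 \o t1) x) rK.
have [r' [_ r'K]] := linear_inv (surj_endo_bij (presented_fin_gen H) bS).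
by exists (sig \o r') => x; apply: r'K.
Qed.

Lemma tau_inv_iso X T Y U : isomorphic X Y -> tau_inv X T -> tau_inv Y U ->
    isomorphic T U.
Proof.
move=> [f /linear_inv[g [fK gK]]] /tau_inv_presented[P1 [P0 [d [p [c H]]]]].
move=> /tau_inv_presented[Q1 [Q0 [d' [p' [c' H']]]]].
have surj (M N : lmodType A) (k : {linear M -> N}) : split_epi k -> surjective k.
  by move=> [s sK] y; exists (s y).
have [b bP] := transports_of_map H' H f.
have [b' b'P] := transports_of_map H H' g.
exists b; apply: (@surj2_bij _ _ _ _ b b'); first exact: presented_fin_gen H.
  by apply: surj; apply: transports_split_epi H' H bP _; exists g.
by apply: surj; apply: transports_split_epi H H' b'P _; exists f.
Qed.

Lemma tau_inv_zero X T : tau_inv X T -> zero_module X -> zero_module T.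
Proof.
move=> /tau_inv_presented[P1 [P0 [d [p [c H]]]]] X0.
have P00 : zero_module P0.
  have /= S0 := pr_ess0 H (g := (\0 : {linear P0 -> P0})).
  move=> x; case: (S0 _ x) => [y|_ <- //]; exists 0; apply: kdual_ext => z.
  by rewrite (X0 z) !kdual0.
have P10 : zero_module P1.
  have /= S1 := pr_ess1 H (g := (\0 : {linear P1 -> P1})).
  by move=> x; case: (S1 _ x) => [y _|_ <- //]; exists 0; rewrite (P00 y) (P00 (d _)).
move=> y; have [phi <-] := pr_csurj H y; rewrite (_ : phi = 0) ?linear0 //.
by apply: ev_ext => x; rewrite (P10 x) !ev0.
Qed.

(** Transport the projection [e] onto a summand of [T] to an endomorphism [beta] of [X]. By locality
    [beta] or 1 - [beta] is bijective, so [e] or 1 - [e] is a split epimorphism, and an idempotent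
    one is the identity. *)
Lemma tau_inv_indecomposable X T : tau_inv X T -> fin_gen X -> indecomposable X ->
  ~ zero_module T -> indecomposable T.
Proof.
move=> /tau_inv_presented[P1 [P0 [d [p [c H]]]]] Xf Xi T0; split=> // U V TUV.
have [f [g [fK gK]]] : exists (f : {linear T ->
  (U * V)%type}) (g : {linear (U * V)%type -> T}),
    cancel f g /\ cancel g f.
  by case: TUV => f /linear_inv[g fg]; exists f, g.
have [j jE] := prod_lin (idfun : {linear U -> U}) (\0 : {linear U -> V}).
have [e eT] : exists e : {linear T -> T}, forall x, e x = g (j (f x).1).
  by exists ((g \o j) \o (fst \o f)).
have ee x : e (e x) = e x by rewrite !eT gK !jE.
have [beta [t0 [t1 [t0E t1E eE]]]] := transports_of_tau H H e Xf.
have e'P : transports d p c d p c (idfun \- e) (idfun \- beta).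
  exists (idfun \- t0), (idfun \- t1); split=> [x y|x|psi] /=.
  - by rewrite linearB kdualB -t0E.
  - by rewrite !linearB /= t1E.
  - rewrite eE -linearB; congr (c _); apply: ev_ext => x.
    by rewrite rdualE /= evB ev_subE rdualE.
have epi_id (k : {linear T -> T}) : (forall x, k (k x) = k x) -> split_epi k ->
  forall x, k x = x.
  by move=> kk [s sK] x; rewrite -(sK x) kk.
case: (@indecomposable_endo_local _ _ X beta (idfun \- beta)) => //.
- by move=> x /=; rewrite addrC subrK.
- move=> /linear_inv[s [_ sK]]; right=> v.
  have eS : split_epi e.
    by apply: (transports_split_epi (beta := beta) H H); [exists t0, t1 | exists s].
  have := epi_id e ee eS (g (0, v)); rewrite eT gK jE => /(can_inj gK).
  by move=> -[].
- move=> /(@linear_inv _ _ _ (idfun \- beta))[s [_ sK]]; left=> u.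
  have eS : split_epi (idfun \- e).
    by apply: (transports_split_epi H H e'P); exists s.
  have ee' x : (idfun \- e) ((idfun \- e) x) = (idfun \- e) x.
    by rewrite [LHS]/= linearB ee subrr subr0.
  have /eqP := epi_id _ ee' eS (g (u, 0)).
  rewrite /= -subr_eq0 addrAC subrr add0r oppr_eq0 eT gK jE /= => /eqP.
  by rewrite -(linear0 g) => /(can_inj gK) -[].
Qed.

(** A section [q] of [c] gives an idempotent [q \o c] of P1^*, the transpose of some [t] with d t =
    0. Then 1 - [t] still covers Ker p, so it is onto by minimality of the presentation and [t]
    vanishes. *)
Lemma tau_inv_not_projective X T : tau_inv X T -> projective T -> zero_module T.
Proof.
move=> /tau_inv_presented[P1 [P0 [d [p [c H]]]]] Tp.
have [q qK] := projective_split Tp (pr_csurj H).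
have [t tE] := regular_dual_transpose (q \o c) (pr_fg1 H) (pr_proj1 H).
have dt x : d (t x) = 0.
  apply: (ev_sep (pr_fg0 H) (pr_proj0 H)) => psi.
  rewrite -[LHS]rdualE -[LHS]rdualE -tE /= (_ : c _ = 0) ?linear0 ?ev0 //.
  by apply/(pr_cker H); exists psi.
have tt x : t (t x) = t x.
  apply: (ev_sep (pr_fg1 H) (pr_proj1 H)) => phi.
  by rewrite -[LHS]rdualE -[LHS]rdualE -[RHS]rdualE -!tE /= qK.
have gS : surjective (idfun \- t).
  apply: (pr_ess1 H) => x /(pr_exact H)[y yE]; exists y.
  by rewrite /= linearB dt subr0.
have t0 x : t x = 0 by have [z <-] := gS x; rewrite /= linearB tt subrr.
move=> y; have [phi <-] := pr_csurj H y.
rewrite -[LHS]qK -[q _]/((q \o c) phi) tE (_ : rdual t phi = 0) ?linear0 //.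
by apply: ev_ext => x; rewrite rdualE t0 ev0.
Qed.

(* h is connected to a functional on Hom(L, X) that kills the maps that are not
   split epimorphisms but not u. *)
Lemma tau_inv_socle X T L U E W (i : {linear L -> E}) (pi : {linear E -> W})
    (u : {linear L -> X}) :
    tau_inv X T -> tau_inv L U -> fin_gen X -> indecomposable X -> fin_gen E ->
    injective i -> (forall x, pi x = 0 <-> exists y, i y = x) ->
    split_epi u -> (forall v : {linear E -> X}, ~ split_epi (v \o i)) ->
  exists h : {linear T -> W}, ~ factors_through pi h /\
    forall b : {linear U -> T}, ~ split_epi b -> factors_through pi (h \o b).
Proof.
move=> /tau_inv_presented[P1 [P0 [d [p [c H]]]]].
move=> /tau_inv_presented[Q1 [Q0 [d' [p' [c' H']]]]] Xf Xi Ef iI ex uS vS.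
have Lf : fin_gen L by apply: fin_gen_inj Ef iI.
have [n [q [phi qphi]]] := dual_basis_exists (pr_fg0 H) (pr_proj0 H).
have [||g [g0 gu]] := @pairing_sep _ _ P0 n q phi X p L (fun v => ~ split_epi v) u
    qphi Lf Xf (pr_surj H) _ _ (fun f => f uS).
- by move=> v v0 [s sK]; case: Xi => -[] x; rewrite -(sK x) v0.
- move=> k v1 v2 v v1N v2N vE vS'.
  have [w wE] := lin_comb k v1 \0.
  have [|[s sK]|//] := @split_epiD _ _ L X w v2 v Xf Xi _ vS'.
    by move=> x; rewrite vE wE addr0.
  apply: v1N; have [s' s'E] := lin_comb k s \0; exists s' => x.
  by rewrite s'E addr0 linearZ -[RHS]sK wE addr0.
have [v|k [h [kE hE]]] := connecting_exists (i := i) H qphi Xf Ef ex (g := g).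
  exact: g0 (vS v).
exists h; split=> [hl|b bN].
  by apply: gu; apply: connecting_lift H qphi iI ex kE hE hl u.
have [beta be] := transports_of_tau H H' b Xf.
have betaN : ~ split_epi beta by move=> /(transports_split_epi H H' be).
case: be => t0 [t1 [t0E t1E bE]].
have [n' [q' [phi' qphi']]] := dual_basis_exists (pr_fg0 H') (pr_proj0 H').
(* Pairing the composite of [g] with the dual of [t0] against [v] is pairing [g] against
   [beta \o v]. The latter is no split epimorphism, so the value is 0. *)
have [v|k' k'E] := @pairing_factor _ _ _ _ _ _ _ _ _ H' Lf n' q' phi' qphi' L (g \o
  rdual t0) Lf.
  rewrite (pairingE (z := t0 \o q) (l := g \o phi) p' v qphi').
    rewrite -[RHS](g0 (beta \o v)); first by apply: eq_bigr => j _; rewrite /= t0E.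
    by move=> [s sK]; apply: betaN; exists (v \o s) => x; apply: sK.
  move=> j; rewrite /= {1}(dual_basis_expand (rdual t0 (phi' j)) qphi) linear_sum.
  by apply: eq_bigr => l _; rewrite linearZ rdualE.
(* The correction by [i \o k'] makes the map vanish on the kernel of [c'] and is invisible after
   [pi]. *)
have [psi|h' h'E] := factor_surj (k := (k \o rdual t1) \- (i \o k')) (pr_csurj H').
  move=> /(pr_cker H')[chi ->].
  by rewrite /= -k'E (rdual_commute _ t1E) -kE subrr.
exists h' => x; have [psi <-] := pr_csurj H' x.
rewrite /= bE hE h'E /= linearB.
have -> : pi (i (k' psi)) = 0 by apply/ex; exists (k' psi).
by rewrite subr0.
Qed.
End Transport.

(** * The intrinsic kernel *)

Section IntrinsicKernel.
Variables (K : fieldType) (A : falgType K).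
Implicit Types (B C D E L M N P T W X Y Z : lmodType A).

Lemma internal_dsum_proj M (U V : submodClosed M) : internal_dsum U V ->
  exists r : {linear M -> submod V},
    (forall x, x - \val (r x) \in U) /\ forall v, r (\val v) = v.
Proof.
move=> [UV0 UV].
have uniq x (v v' : submod V) : x - \val v \in U -> x - \val v' \in U -> v = v'.
  move=> xv xv'; apply: val_inj; apply/eqP; rewrite -subr_eq0; apply/eqP/UV0.
    rewrite (_ : _ - _ = (x - \val v') - (x - \val v)); first exact: submodB.
    by rewrite opprB [RHS]addrC addrA subrK.
  by apply: submodB; apply: valP.
have [||r rP] := @choose_linear _ M (submod V) (fun x v => x - \val v \in U).
- by move=> x; have [u uU [v vV ->]] := UV x; exists (Submod vV); rewrite addrK.
- move=> a x x' y y' z yU y'U zU; apply: uniq zU _.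
  have -> : a *: x + x' - \val (a *: y + y') = a *: (x - \val y) + (x' - \val y').
    by rewrite (linearP (\val : {linear submod V -> M})) opprD scalerBr addrACA.
  by rewrite rpredD // rpredZ.
exists r; split=> // v; apply: uniq (rP _) _; by rewrite subrr rpred0.
Qed.

(** Take an idempotent [e] with f e = f and image of least dimension; its kernel and image are B1
    and B2. Fitting's projection of an endomorphism of B2 over D, carried to B, is again such an
    idempotent, so it is the identity on B2. *)
Lemma intrinsic_kernel_exists B D (f : {linear B -> D}) : fin_gen B ->
  exists L, intrinsic_kernel f L.
Proof.
move=> Bf.
pose Q k := `[< exists e : {linear B -> B}, [/\ forall x, e (e x) = e x,
  forall x, f (e x) = f x & kdim (submod (mod_im e)) = k] >].
have [|k /asboolP[e [ee fe ek]] kmin] := @ex_minnP Q.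
  by exists (kdim (submod (mod_im (idfun : {linear B -> B})))); apply/asboolP;
    exists idfun.
pose f2 : {linear submod (mod_im e) -> D} := f \o \val.
have eV (v : submod (mod_im e)) : e (\val v) = \val v.
  by have /mod_imP[x <-] := valP v; rewrite ee.
have vI : injective (\val : {linear submod (mod_im e) -> B}) by apply: val_inj.
have Ef : fin_gen (submod (mod_im e)) by apply: fin_gen_inj Bf vI.
have [r rE] : exists r : {linear B -> submod (mod_im e)}, forall x, \val (r x) = e x.
  by apply: corestrict => x; apply/mod_imP; exists x.
exists (submod (mod_ker f2)), (mod_ker e), (mod_im e); split;
  last exact: isomorphic_refl.
- split=> [x /eqP ex /mod_imP[y yx]|x]; first by rewrite -yx -ee yx.
  exists (x - e x); first by rewrite inE linearB ee subrr.
  by exists (e x); [apply/mod_imP; exists x | rewrite subrK].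
- by move=> x /eqP ex; rewrite inE -fe ex linear0.
- move=> g fg; have [n [e' [ee' e'0 e'im e'iter]]] := fitting g Ef.
  have fiter m x : f2 (iter m g x) = f2 x by elim: m => // m <-; apply: fg.
  have fe' x : f2 (e' x) = f2 x.
    apply/eqP; rewrite -subr_eq0 -linearB; apply/eqP; rewrite -(fiter n.+1).
    by rewrite (proj1 (e'0 _)) ?linear0 // linearB ee' subrr.
  pose e2 : {linear B -> B} := \val \o (e' \o r).
  have rV v : r (\val v) = v by apply: val_inj; rewrite rE eV.
  have [|j jE] := @corestrict _ _ (mod_im e) (submod (mod_im e2)) \val.
    by case=> x xP /=; have /mod_imP[y <-] := xP; apply: valP.
  have jI : injective j by move=> u v uv; apply: val_inj; rewrite -!jE uv.
  have [le jS] := kdim_inj Ef jI.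
  have e'id x : e' x = x.
    have [|z zE] := jS _ x.
      apply/eqP; rewrite eqn_leq le ek; apply: kmin; apply/asboolP; exists e2.
      by split=> // y; rewrite /e2 /= ?rV ?ee' // -[LHS]/(f2 _) fe' /f2 /= rE fe.
    rewrite -zE; have /mod_imP[y yE] := valP z.
    have -> : j z = e' (r y) by apply: val_inj; apply: etrans (jE z) (esym yE).
    by rewrite ee'.
  apply: (inj_endo_bij Ef); apply/lin_inj => x x0.
  by rewrite -(e'id x); apply/e'0; rewrite iterSr x0;
    elim: n {e'0 e'im e'iter} => //= n ->; rewrite linear0.
Qed.

(** [f] and its right minimal part [f2] factor through each other, so the same maps factor through
    both; the rest of the proof works with [f2]. *)
Lemma intrinsic_kernelP B D (f : {linear B -> D}) L : intrinsic_kernel f L ->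
  exists E (f2 : {linear E -> D}) (j : {linear E -> B}) (r : {linear B -> E})
      (i : {linear L -> E}),
    [/\ cancel j r, forall x, f (j x) = f2 x, forall x, f2 (r x) = f x,
        right_minimal f2 & injective i /\ forall x, f2 x = 0 <-> exists y, i y = x].
Proof.
move=> [B1 [B2 /= [B12 B1f f2min [g /bijP[gI gS]]]]].
have [r [rU rV]] := internal_dsum_proj B12.
exists (submod B2), (f \o \val), \val, r, (\val \o g); split=> //.
- move=> x /=; apply/eqP; rewrite -subr_eq0 -linearB -oppr_eq0 -linearN opprB.
  exact: B1f.
- split=> [x y /= /val_inj/gI //|x]; split=> [fx|[y <-]].
    have xk : x \in mod_ker (f \o \val : {linear submod B2 -> D}) by rewrite inE fx.
    by have [y yE] := gS (Submod xk); exists y; rewrite /= yE.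
  by have /eqP := valP (g y).
Qed.

(** The comparison maps between two right minimal parts have both composites over D, hence
    bijective, and they restrict to the kernels. *)
Lemma intrinsic_kernel_iso B D (f : {linear B -> D}) L M :
  intrinsic_kernel f L -> intrinsic_kernel f M -> isomorphic L M.
Proof.
move=> /intrinsic_kernelP[E [f2 [j [r [i [jK jE rE fmin [iI ex]]]]]]].
move=> /intrinsic_kernelP[E' [f2' [j' [r' [i' [j'K j'E r'E fmin' [i'I ex']]]]]]].
pose a : {linear E -> E'} := r' \o j; pose b : {linear E' -> E} := r \o j'.
have fa x : f2' (a x) = f2 x by rewrite r'E jE.
have fb x : f2 (b x) = f2' x by rewrite rE j'E.
have /bijP[_ abS] : bijective (a \o b) by apply: fmin' => x; rewrite /= fa fb.
have /bijP[baI _] : bijective (b \o a) by apply: fmin => x; rewrite /= fb fa.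
have [|h hE] := @factor_inj _ M E' L i' (a \o i) i'I.
  by move=> x; apply/ex'; rewrite /= fa; apply/ex; exists x.
exists h; apply/bijP; split.
  move=> x y xy; apply: iI; apply: baI; rewrite /=; congr (b _).
  by have := hE x; rewrite xy hE.
move=> y; have [z zE] := abS (i' y).
have /ex[x xE] : f2 (b z) = 0 by rewrite -fa [a _]zE; apply/ex'; exists y.
by exists x; apply: i'I; rewrite hE /= xE.
Qed.

(** For a section [s], the map 1 - i s v lies over D, so it is bijective, but it kills i s. *)
Lemma right_minimal_not_split B D (f : {linear B -> D}) L X (i : {linear L -> B})
    (v : {linear B -> X}) :
    right_minimal f -> (forall x, f (i x) = 0) -> ~ zero_module X ->
  ~ split_epi (v \o i).
Proof.
move=> fmin fi X0 [s vs]; apply: X0 => x; have sK : v (i (s x)) = x := vs x.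
have /bijP[/lin_inj eI _] : bijective (idfun \- (i \o (s \o v))).
  by apply: fmin => y; rewrite /= linearB fi subr0.
have is0 : i (s x) = 0 by apply: eI; rewrite /= sK subrr.
by rewrite -sK is0 linear0.
Qed.

Lemma fin_gen_prod M N : fin_gen M -> fin_gen N -> fin_gen (M * N)%type.
Proof.
move=> [m [u uP]] [n [v vP]].
exists (m + n)%N, (fun k => match fintype.split k with inl k => (u k,
  0) | inr k => (0, v k) end).
case=> x y; have [a ->] := uP x; have [b ->] := vP y.
exists (fun k => match fintype.split k with inl k => a k | inr k => b k end).
have fstE (I : finType) (F : I -> (M * N)%type) : (\sum_i F i).1 = \sum_i (F i).1.
  exact: (linear_sum (fst : {linear (M * N)%type -> M})).
have sndE (I : finType) (F : I -> (M * N)%type) : (\sum_i F i).2 = \sum_i (F i).2.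
  exact: (linear_sum (snd : {linear (M * N)%type -> N})).
rewrite big_split_ord /=.
under [in X in _ = X + _]eq_bigr do rewrite (unsplitK (inl _)).
under [in X in _ = _ + X]eq_bigr do rewrite (unsplitK (inr _)).
congr (_, _); rewrite -/(fst _) -/(snd _) ?fstE ?sndE /=.
  by rewrite [X in _ = _ + X]big1 ?addr0 // => k _; rewrite scaler0.
by rewrite [X in _ = X + _]big1 ?add0r // => k _; rewrite scaler0.
Qed.

Lemma dependent_choice (I : Type) (F : I -> Type) (Q : forall k, F k -> Prop) :
  (forall k, exists v, Q k v) -> exists v : forall k, F k, forall k, Q k (v k).
Proof. by move=> H; exists (fun k => projT1 (cid (H k))) => k; case: (cid _). Qed.

(* Pull f back along f' and apply [tau_inv_lift] to each [rho k]: the identity of L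
   extends to the pullback, so that the pulled back sequence splits. *)
Lemma tau_inv_determines E D L W (f : {linear E -> D}) (i : {linear L -> E})
    (f' : {linear W -> D}) (I : finType) (X T : I -> lmodType A)
    (io : forall k, {linear X k -> L}) (rho : forall k, {linear L -> X k}) :
    fin_gen E -> fin_gen W -> injective i ->
      (forall x, f x = 0 <-> exists y, i y = x) ->
    (forall x, \sum_k io k (rho k x) = x) -> (forall k, fin_gen (X k)) ->
    (forall k, tau_inv (X k) (T k)) -> (forall w, exists x, f x = f' w) ->
    (forall k (a : {linear T k -> W}), factors_through f (f' \o a)) ->
  factors_through f f'.
Proof.
move=> Ef Wf iI ex ioE Xf XT fim fT.
pose V : submodClosed (E * W)%type := mod_ker ((f \o fst) \- (f' \o snd)).
have VP (z : submod V) : f (\val z).1 = f' (\val z).2.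
  by have := valP z; rewrite inE /= subr_eq0 => /eqP.
have Vf : fin_gen (submod V).
  by apply: (fin_gen_inj (g := \val)) (fin_gen_prod Ef Wf) _; apply: val_inj.
have pair (M : lmodType A) (a : {linear M -> E}) (b : {linear M -> W}) :
    (forall x, f (a x) = f' (b x)) ->
    exists h : {linear M -> submod V}, forall x, \val (h x) = (a x, b x).
  move=> ab; have [h0 h0E] := prod_lin a b.
  have [|h hE] := @corestrict _ _ V M h0; last by exists h => x; rewrite hE h0E.
  by move=> x; rewrite inE /= h0E /= ab subrr.
have [|i' i'E] := pair L i \0.
  by move=> x; rewrite /= linear0; apply/ex; exists x.
have i'I : injective i' by move=> x y /(congr1 \val); rewrite !i'E => -[/iI].
pose pi : {linear submod V -> W} := snd \o \val.
have piE z : pi z = 0 <-> exists y, i' y = z.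
  split=> [z0|[y <-]]; last by rewrite /pi /= i'E.
  have /ex[y yE] : f (\val z).1 = 0 by rewrite VP [(\val z).2]z0 linear0.
  exists y; apply: val_inj; rewrite i'E yE; move: z0; rewrite /pi /=.
  by case: (\val z) => a b /= ->.
have /dependent_choice[v vP] : forall k, exists v : {linear submod V ->
  X k}, forall x, v (i' x) = rho k x.
  move=> k; apply: (tau_inv_lift (rho k) (XT k) (Xf k) Vf i'I piE) => phi.
  have [h hE] := fT k phi; have [|h' h'E] := pair _ h phi.
    by move=> x; rewrite -hE.
  by exists h' => x; rewrite /pi /= h'E.
(* [r] is a retraction of [i']; the first component of 1 - i' r kills [i'] and descends along [pi]
   to the lift of [f']. *)
have [r rE] := sum_lin (fun k => io k \o v k).
have ri x : r (i' x) = x by rewrite rE -[RHS]ioE; apply: eq_bigr => k _ /=; rewrite vP.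
have [|z|h hE] := factor_surj (c := pi) (k := (fst \o \val) \o (idfun \- (i' \o r))).
- move=> w; have [x xE] := fim w.
  have xV : (x, w) \in V by rewrite inE /= xE subrr.
  by exists (Submod xV).
- by move=> /piE[y <-]; rewrite /= ri subrr.
exists h => w; have [x xE] := fim w.
have xV : (x, w) \in V by rewrite inE /= xE subrr.
have /= := hE (Submod xV); rewrite /pi /= => ->.
rewrite linearB /= xE i'E; rewrite (_ : f (i _) = 0) ?subr0 //.
by apply/ex; exists (r (Submod xV)).
Qed.
End IntrinsicKernel.

(** * The minimal right determiner *)

Section Determiner.
Variables (K : fieldType) (A : falgType K).
Implicit Types (B C D E L M N P Q T U V W X Y Z : lmodType A).

Lemma factors_through_intrinsic B D E W (f : {linear B -> D}) (f2 : {linear E -> D})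
    (j : {linear E -> B}) (r : {linear B -> E}) (g : {linear W -> D}) :
    (forall x, f (j x) = f2 x) -> (forall x, f2 (r x) = f x) ->
  factors_through f g <-> factors_through f2 g.
Proof.
move=> jE rE; split=> [[h hE]|[h hE]]; first by exists (r \o h) => x /=; rewrite rE.
by exists (j \o h) => x /=; rewrite jE.
Qed.

Lemma almost_factors_radical P C D M (f : {linear M -> D}) (h : {linear P -> D})
    (u : {linear submod (mod_rad P) -> M}) (phi : {linear C -> P}) :
    fin_gen P -> projective P -> indecomposable P -> (forall x, h (\val x) = f (u x)) ->
    ~ split_epi phi ->
  factors_through f (h \o phi).
Proof.
move=> Pf Pp Pi hu phiN; have [|phi' phi'E] := @corestrict _ _ (mod_rad P) C phi.
  move=> x; apply: (@proper_subset_rad _ _ P (mod_im phi) Pf Pp Pi); last first.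
    by apply/mod_imP; exists x.
  apply: contrapT => phiS; apply: phiN; apply: (projective_split Pp) => y.
  by apply/mod_imP/negPn/negP => yN; apply: phiS; exists y.
by exists (u \o phi') => x; rewrite /= -phi'E hu.
Qed.

(** [tau_inv_socle] controls only composites with maps from tau^-1 L. A general [C] is reached
    because maps into the image of [f2] are tested on tau^-1 L, and [phi \o a] is no split
    epimorphism if [phi] is none. *)
Lemma tau_inv_almost_factors B D (f : {linear B -> D}) Z : fin_gen B ->
    tau_inv_of_intrinsic_kernel f Z ->
  exists h : {linear Z -> D}, ~ factors_through f h /\
    forall C (phi : {linear C -> Z}), fin_gen C -> ~ split_epi phi ->
      factors_through f (h \o phi).
Proof.
move=> Bf [_ [L [X [/intrinsic_kernelP[E [f2 [j [r [i [jK jE rE fmin [iI ex]]]]]]]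
  Xi /retractP[io [rho rhoK]] XZ]]]].
have Ef : fin_gen E by apply: (fin_gen_inj (g := j)) Bf (can_inj jK).
have Lf : fin_gen L by apply: (fin_gen_inj (g := i)) Ef iI.
have Xf : fin_gen X by apply: (fin_gen_inj (g := io)) Lf (can_inj rhoK).
have [U LU] := tau_inv_exists Lf.
have [|pi piE] := @corestrict _ _ (mod_im f2) E f2.
  by move=> x; apply/mod_imP; exists x.
have pi0 x : pi x = 0 <-> exists y, i y = x.
  rewrite -ex; split=> [x0|x0]; first by rewrite -piE x0.
  by apply: val_inj; rewrite piE.
have [||h [hN hb]] := tau_inv_socle XZ LU Xf Xi Ef iI pi0 (u := rho).
- by exists io.
- move=> v; apply: right_minimal_not_split fmin _ _; last by case: Xi.
  by move=> x; apply/ex; exists x.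
have fh W (k : {linear W -> Z}) : factors_through f (\val \o h \o k) <->
    factors_through pi (h \o k).
  rewrite (factors_through_intrinsic _ jE rE); split=> -[k' k'E]; exists k' => x.
    by apply: val_inj; rewrite piE -k'E.
  by rewrite -piE -k'E.
exists (\val \o h); split=> [[k kE]|C phi Cf phiN].
  have /fh[k' k'E] : factors_through f (\val \o h \o idfun) by exists k.
  by apply: hN; exists k'.
apply/(factors_through_intrinsic _ jE rE).
(* The one-term decomposition of [L], which may be decomposable. *)
apply: (@tau_inv_determines _ _ E D L C f2 i _ unit (fun=> L) (fun=> U)
  (fun=> idfun) (fun=> idfun)) => //.
- by move=> x; rewrite big_const card_unit /= addr0.
- by move=> w; apply/mod_imP; apply: valP.
move=> _ a; apply/(factors_through_intrinsic _ jE rE)/(fh U (phi \o a))/hb.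
by move=> [s sK]; apply: phiN; exists (a \o s).
Qed.

Lemma right_determined_retract B D (f : {linear B -> D}) C Z (h : {linear Z -> D}) :
    right_determined f C -> fin_gen Z -> ~ factors_through f h ->
    (forall phi : {linear C -> Z}, ~ split_epi phi -> factors_through f (h \o phi)) ->
  retract Z C.
Proof.
move=> fC Zf hN hphi; apply: contrapT => ZC; apply: hN; apply: fC => // phi.
by apply: hphi => -[s sK]; apply: ZC; exists s, phi.
Qed.

(* If f' does not land in the image of f, then [local_projective_map] gives a
   projective P whose radical does; the map rad P -> D lifts to B by
   [tau_inv_determines], so that P almost factors through f. *)
Lemma determiner_determines B D L E (f : {linear B -> D}) (f2 : {linear E -> D})
    (j : {linear E -> B}) (r : {linear B -> E}) (i : {linear L -> E})
    (I : finType) (X T : I -> lmodType A) (io : forall k, {linear X k -> L})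
    (rho : forall k, {linear L -> X k}) W (f' : {linear W -> D}) :
    fin_gen E -> fin_gen W ->
    (forall x, f (j x) = f2 x) -> (forall x, f2 (r x) = f x) ->
    injective i -> (forall x, f2 x = 0 <-> exists y, i y = x) ->
    (forall x, \sum_k io k (rho k x) = x) -> (forall k, fin_gen (X k)) ->
    (forall k, tau_inv (X k) (T k)) ->
    (forall k (a : {linear T k -> W}), factors_through f (f' \o a)) ->
    (forall P (a : {linear P -> W}), almost_factoring_projective f P ->
       factors_through f (f' \o a)) ->
  factors_through f f'.
Proof.
move=> Ef Wf jE rE iI ex ioE Xf XT fT fP.
have fI2 V (g : {linear V -> D}) := factors_through_intrinsic g jE rE.
have [[x0 x0N]|im] := EM (exists x, f' x \notin mod_im f2); last first.
  apply/fI2; apply: (tau_inv_determines (T := T) (rho :=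
    rho)) iI ex ioE Xf XT _ _ => //.
    by move=> w; apply/mod_imP/negPn/negP => wN; apply: im; exists w.
  by move=> k a; apply/fI2.
have [|P [k [Pf Pp Pi [p pN] radP]]] := local_projective_map (f := f') Wf (W :=
  mod_im f2).
  by exists x0.
have Rf : fin_gen (submod (mod_rad P)).
  by apply: (fin_gen_inj (g := \val)) Pf _; apply: val_inj.
have /fI2[u uE] : factors_through f (f' \o (k \o (\val :
  {linear submod (mod_rad P) -> P}))).
  apply/fI2; apply: (tau_inv_determines (T := T) (rho :=
    rho)) iI ex ioE Xf XT _ _ => //.
    by move=> w; apply/mod_imP/radP/valP.
  by move=> l a; apply/fI2; exact: (fT l (k \o (\val \o a))).
have Paf : almost_factors P f.
  exists (j \o u), (f' \o k); split=> [x|im]; first by rewrite /= jE -uE.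
  by case/negP: pN; have [m mE] := im p; apply/mod_imP; exists (r m); rewrite rE.
have [|h hE] := fP P k; first by split.
by case/negP: pN; apply/mod_imP; exists (r (h p)); rewrite rE -hE.
Qed.

Lemma in_addP C M : in_add C M <-> exists n, retract M (dsum (fun _ : 'I_n => C)).
Proof. by split=> -[n /retractP Mn]; exists n. Qed.

Lemma dsum_in_add C n (Z : 'I_n -> lmodType A) : (forall k, retract (Z k) C) ->
  in_add C (dsum Z).
Proof.
move=> ZC; apply/in_addP; exists n.
have [i /dependent_choice[r rK]] := dependent_choice ZC.
have [h hE] := dsum_pair (fun k => i k \o dsum_proj Z k).
have [h' h'E] := dsum_pair (fun k => r k \o dsum_proj (fun _ : 'I_n => C) k).
exists h, h' => x; apply/ffunP => k.
transitivity (dsum_proj Z k (h' (h x))) => //.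
rewrite h'E [LHS]/= -[h x k]/(dsum_proj (fun _ : 'I_n => C) k (h x)) hE.
exact: rK.
Qed.

Lemma retract_in_add C M N : retract N M -> in_add C M -> in_add C N.
Proof.
by move=> NM /in_addP[n Mn]; apply/in_addP; exists n; apply: retract_trans NM Mn.
Qed.

Lemma in_add_factors B D (f : {linear B -> D}) C Z W (f' : {linear W -> D}) :
    in_add C Z -> (forall phi : {linear C -> W}, factors_through f (f' \o phi)) ->
  forall phi : {linear Z -> W}, factors_through f (f' \o phi).
Proof.
move=> /in_addP[n [i [r rK]]] fC phi.
have /choice[h hE] : forall k : 'I_n, exists h : {linear C -> B},
    forall x, f' (phi (r (dsum_inj (fun _ => C) k x))) = f (h x).
  by move=> k; apply: (fC (phi \o (r \o dsum_inj (fun _ => C) k))).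
have [g gE] := sum_lin (fun k => h k \o (dsum_proj (fun _ => C) k \o i)).
exists g => x; rewrite gE linear_sum /= -{1}(rK x) -{1}(dsum_sumE (i x)) !linear_sum.
by apply: eq_bigr => k _; rewrite hE.
Qed.

Definition determiner_part B D (f : {linear B -> D}) Z :=
  tau_inv_of_intrinsic_kernel f Z \/ almost_factoring_projective f Z.

(** A part may come from any intrinsic kernel; all of them are isomorphic to a fixed [L], so
    Krull-Schmidt leaves finitely many translates. *)
Lemma determiner_part_finite B D (f : {linear B -> D}) : fin_gen B ->
  exists (I : finType) (N : I -> lmodType A),
    forall Z, determiner_part f Z -> exists k, isomorphic Z (N k).
Proof.
move=> Bf; have [L fL] := intrinsic_kernel_exists f Bf.
have Lf : fin_gen L.
  have [E [_ [j [r [i [jK _ _ _ [iI _]]]]]]] := intrinsic_kernelP fL.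
  by apply: (fin_gen_inj (g := j \o i)) Bf _; apply: inj_comp (can_inj jK) iI.
have [I [X [i [r Xd]]]] := decompositionP Lf.
have [Xi iK _] := Xd.
have Xf k : fin_gen (X k) by apply: (fin_gen_inj (g := i k)) Lf (can_inj (iK k)).
have /choice[T XT] : forall k, exists T, tau_inv (X k) T by move=> k;
  apply: tau_inv_exists.
have [J [Q QP]] := @indecomposable_projectives_finite K A.
exists (I + J)%type, (fun k => match k with inl k => T k | inr k => Q k end) => Z [].
  move=> [_ [L' [X' [fL' X'i /retractP X'L' X'Z]]]].
  have X'L := retract_trans X'L' (isomorphic_retract (intrinsic_kernel_iso fL' fL)).
  have [k X'X] := krull_schmidt Lf X'i X'L Xd.
  by exists (inl k); apply: tau_inv_iso X'X X'Z (XT k).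
move=> [Zf Zp Zi _]; have [k Zk] := QP Z Zf Zp Zi; by exists (inr k).
Qed.

Lemma determiner_part_fin_gen B D (f : {linear B -> D}) Z : determiner_part f Z ->
    fin_gen Z.
Proof.
case=> [[_ [L [X [_ _ _ /tau_inv_presented[P1 [P0 [d [p [c H]]]]]]]]]|[//]].
exact: presented_fin_gen H.
Qed.

Lemma determiner_part_retract B D (f : {linear B -> D}) C Z : fin_gen B -> fin_gen C ->
  right_determined f C -> determiner_part f Z -> retract Z C.
Proof.
move=> Bf Cf fC Zpart; have Zf := determiner_part_fin_gen Zpart.
case: Zpart => [/(tau_inv_almost_factors Bf)[h [hN hphi]]|[_ Zp Zi [u [h [hu hN]]]]].
  by apply: right_determined_retract fC Zf hN _ => phi; apply: hphi.
apply: (right_determined_retract (h := h) fC Zf) => [[k kE]|phi phiN].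
  by apply: hN => p; exists (k p).
exact: (almost_factors_radical Zf Zp Zi hu phiN).
Qed.

Lemma right_determinedP B D (f : {linear B -> D}) Cf C :
    fin_gen B -> minimal_right_determiner f Cf -> fin_gen C ->
  right_determined f C <-> in_add C Cf.
Proof.
move=> Bf [n [Z [[Zpart _ Zc] CfZ]]] Cfg; split=> [fC|CCf].
  apply: retract_in_add (isomorphic_retract CfZ) _; apply: dsum_in_add => k.
  exact: determiner_part_retract fC (Zpart k).
move=> W f' Wf fC.
have fpart V (a : {linear V -> W}) : determiner_part f V -> factors_through f (f' \o a).
  move=> /Zc[k VZ]; apply: in_add_factors fC a; apply: retract_in_add CCf.
  apply: retract_trans (isomorphic_retract VZ) _.
  apply: retract_trans (isomorphic_retract (isomorphic_sym CfZ)).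
  by exists (dsum_inj Z k), (dsum_proj Z k); apply: dsum_injK.
have [L fL] := intrinsic_kernel_exists f Bf.
have [E [f2 [j [r [i [jK jE rE _ [iI ex]]]]]]] := intrinsic_kernelP fL.
have Ef : fin_gen E by apply: (fin_gen_inj (g := j)) Bf (can_inj jK).
have Lf : fin_gen L by apply: (fin_gen_inj (g := i)) Ef iI.
have [I [X [io [rho [Xi ioK ioE]]]]] := decompositionP Lf.
have Xf k : fin_gen (X k) by apply: (fin_gen_inj (g := io k)) Lf (can_inj (ioK k)).
have /choice[T XT] : forall k, exists T, tau_inv (X k) T by move=> k;
  apply: tau_inv_exists.
apply: (determiner_determines Ef Wf jE rE iI ex ioE Xf XT) => [k a|P a Pf]; last first.
  by apply: fpart; right.
(* A zero translate is no part of C(f), but maps from it factor trivially. *)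
have [T0|T0] := EM (zero_module (T k)).
  by exists \0 => x; rewrite /= (T0 x) !linear0.
apply: fpart; left; split; first exact: tau_inv_indecomposable (XT k) (Xf k) (Xi k) T0.
by exists L, (X k); split=> //; apply/retractP; exists (io k), (rho k).
Qed.

(** In the factorisation f = f2 r, a split epimorphism [f2] would make [f] one, so [r] is a split
    monomorphism and nothing is split off from B. *)
Lemma irreducible_intrinsic_kernel B D (f : {linear B -> D}) L :
    irreducible_map f -> fin_gen B -> intrinsic_kernel f L ->
  isomorphic L (submod (mod_ker f)).
Proof.
move=> [fM fE firr] Bf /intrinsic_kernelP[E [f2 [j [r [i [jK jE rE _ [iI ex]]]]]]].
have Ef : fin_gen E by apply: (fin_gen_inj (g := j)) Bf (can_inj jK).
have rI : injective r.
  case: (firr E r f2 Ef) => [x|[s sK]|[s sK]]; first by rewrite rE.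
    exact: can_inj sK.
  by case: fE; exists (j \o s) => x; rewrite /= jE sK.
have [|h hE] := @corestrict _ _ (mod_ker f) L (j \o i).
  by move=> x; apply/eqP; rewrite /= jE; apply/ex; exists x.
exists h; apply/bijP; split=> [x y xy|[x xk]].
  by apply: iI; apply: (can_inj jK); rewrite -[LHS]hE xy hE.
have /ex[y yE] : f2 (r x) = 0 by rewrite rE; apply/eqP.
by exists y; apply: val_inj; rewrite hE /= yE; apply: rI; rewrite jK.
Qed.

(* If Ker f = U + V, irreducibility makes B / U -> D and B / V -> D split epi;
   B is the pullback of the two, so that f would be split epi as well. *)
Lemma irreducible_kernel_indecomposable B D (f : {linear B -> D}) :
    irreducible_map f -> fin_gen B -> ~ zero_module (submod (mod_ker f)) ->
  indecomposable (submod (mod_ker f)).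
Proof.
move=> [fM fE firr] Bf k0; split=> // U V [g /linear_inv[h [gK hK]]].
have [iU iUE] := prod_lin (idfun : {linear U -> U}) (\0 : {linear U -> V}).
have [iV iVE] := prod_lin (\0 : {linear V -> U}) (idfun : {linear V -> V}).
have kerf (x : submod (mod_ker f)) : f (\val x) = 0 by have /eqP := valP x.
have section (V' : lmodType A) (k : {linear V' -> submod (mod_ker f)}) :
    ~ zero_module V' -> injective k ->
    exists Q (c : {linear B -> Q}) (s : {linear D -> Q}),
      [/\ surjective c, forall x, c x = 0 <-> exists y, \val (k y) = x
        & forall y x, c x = s y -> f x = y].
  move=> V'0 kI; have [Q [c [cS cK]]] := quotient_exists (mod_im (\val \o k)).
  have c0 x : c x = 0 <-> exists y, \val (k y) = x.
    by rewrite cK; split=> [/mod_imP|?]; last exact/mod_imP.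
  have [x|f' f'E] := factor_surj (k := f) cS.
    by move=> /c0[y <-].
  case: (firr Q c f' (fin_gen_surj Bf cS)) => [x|[s sK]|[s sK]]; first by rewrite f'E.
    case: V'0 => y; apply: kI; apply: val_inj; rewrite linear0.
    by apply: (can_inj sK); rewrite !linear0; apply/c0; exists y.
  by exists Q, c, s; split=> // y x cx; rewrite -f'E cx sK.
apply: contrapT => /not_orP[U0 V0].
have [|Q [c [s [cS c0 cs]]]] := section U (h \o iU) U0.
  by move=> x y /= /(can_inj hK); rewrite !iUE => -[].
have [|Q' [c' [s' [c'S c'0 cs']]]] := section V (h \o iV) V0.
  by move=> x y /= /(can_inj hK); rewrite !iVE => -[].
have uniq x y : c x = c y -> c' x = c' y -> x = y.
  move=> cxy c'xy; have /c0[u uE] : c (x - y) = 0 by rewrite linearB cxy subrr.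
  have /c'0[v vE] : c' (x - y) = 0 by rewrite linearB c'xy subrr.
  have /val_inj/(can_inj hK) : \val (h (iU u)) = \val (h (iV v)) by rewrite [LHS]uE -vE.
  rewrite iUE iVE => -[u0 _]; apply/eqP; rewrite -subr_eq0 -uE /= u0.
  by rewrite !linear0.
have [||t tP] := @choose_linear _ D B (fun y x => c x = s y /\ c' x = s' y).
- move=> y; have [x1 x1E] := cS (s y); have [x2 x2E] := c'S (s' y).
  have xk : x1 - x2 \in mod_ker f by rewrite inE linearB (cs y) // (cs' y) // subrr.
  (* The lifts [x1] and [x2] differ by an element of U + V. Moving [x1] by the U-part and [x2] by
     the V-part makes them meet without changing their classes mod U and mod V. *)
  pose w := g (Submod xk); exists (x1 - \val (h (iU w.1))).
  have E : x1 - \val (h (iU w.1)) = x2 + \val (h (iV w.2)).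
    have wE : iV w.2 + iU w.1 = w.
      by rewrite iVE iUE; case: (w) => a b; congr (_, _) => /=; rewrite ?addr0 ?add0r.
    have ba : \val (h (iV w.2)) + \val (h (iU w.1)) = x1 - x2.
      by rewrite -linearD -linearD wE gK.
    by apply/eqP; rewrite subr_eq -addrA ba addrC subrK.
  split; last rewrite E.
    rewrite linearB x1E (_ : c (\val _) = 0) ?subr0 //.
    by apply/c0; exists w.1.
  rewrite linearD x2E (_ : c' (\val _) = 0) ?addr0 //.
  by apply/c'0; exists w.2.
- move=> a y y' x x' z [xE xE'] [x'E x'E'] [zE zE']; apply: uniq.
    by rewrite zE !linearP xE x'E.
  by rewrite zE' !linearP xE' x'E'.
by apply: fE; exists t => y; have [tE _] := tP y; apply: cs.
Qed.
End Determiner.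

Section IrreducibleDeterminer.
Variables (K : fieldType) (A : falgType K).
Implicit Types (B C D E L M N P Q T U V W X Y Z : lmodType A).

Lemma dsum_biproduct n (Z : 'I_n -> lmodType A) :
  biproduct (dsum_inj Z) (dsum_proj Z).
Proof.
split=> [k|k l x|]; [exact: dsum_injK | exact: dsum_inj_proj | exact: dsum_sumE].
Qed.

Lemma inl_lin M N : exists h : {linear M -> (M * N)%type}, forall x, h x = (x, 0).
Proof. exact: (prod_lin (idfun : {linear M -> M}) (\0 : {linear M -> N})). Qed.

Lemma inr_lin M N : exists h : {linear N -> (M * N)%type}, forall x, h x = (0, x).
Proof. exact: (prod_lin (\0 : {linear N -> M}) (idfun : {linear N -> N})). Qed.

(** The index [None] stands for [T], so that the product becomes a sum over a single list. *)
Lemma prod_dsum_biproduct T n (P : 'I_n -> lmodType A) :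
  exists (i : forall o : option 'I_n, {linear oapp P T o -> (T * dsum P)%type})
         (r : forall o : option 'I_n, {linear (T * dsum P)%type -> oapp P T o}),
    biproduct i r.
Proof.
have [a aE] := inl_lin T (dsum P); have [b bE] := inr_lin T (dsum P).
exists (fun o => match o return {linear oapp P T o -> (T * dsum P)%type} with
  | Some k => b \o dsum_inj P k | None => a end).
exists (fun o => match o return {linear (T * dsum P)%type -> oapp P T o} with
  | Some k => dsum_proj P k \o snd | None => fst end).
split=> [[k|] x|[k|] [l|] x|[t u]] //.
- by rewrite [LHS]/= bE; exact: (dsum_injK (X := P)).
- by rewrite /= aE.
- by move=> kl; rewrite [LHS]/= bE; apply: (dsum_inj_proj (X := P));
  apply: contra kl => /eqP->.
- by rewrite /= bE.
- by rewrite /= aE ffunE.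
have bigE (F : option 'I_n ->
  (T * dsum P)%type) : \sum_o F o = F None + \sum_k F (Some k).
  rewrite (bigD1 None) //=; congr (_ + _).
  rewrite (reindex_omap Some id) => [|[k|]] //; apply: eq_bigl => k.
  by rewrite /= eqxx.
rewrite bigE /= -linear_sum aE bE; congr (_, _) => /=; rewrite ?addr0 ?add0r //.
exact: dsum_sumE.
Qed.

Lemma zero_prod_dsum_biproduct T n (P : 'I_n -> lmodType A) : zero_module T ->
  exists (i : forall k, {linear P k -> (T * dsum P)%type})
         (r : forall k, {linear (T * dsum P)%type -> P k}),
    biproduct i r.
Proof.
move=> T0; have [b bE] := inr_lin T (dsum P).
exists (fun k => b \o dsum_inj P k), (fun k => dsum_proj P k \o snd).
split=> [k x|k l x|[t u]].
- by rewrite [LHS]/= bE; exact: (dsum_injK (X := P)).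
- by move=> kl; rewrite [LHS]/= bE; exact: (dsum_inj_proj (X := P)).
by rewrite -linear_sum bE (T0 t) dsum_sumE.
Qed.

Lemma almost_factoring_representatives B D (f : {linear B -> D}) :
  exists n (P : 'I_n -> lmodType A), representatives (almost_factoring_projective f) P.
Proof.
have [I [Q QP]] := @indecomposable_projectives_finite K A.
by apply: (@representativesP _ _ _ I Q) => P [Pf Pp Pi _]; apply: QP.
Qed.

(** Both sides are sums over complete irredundant lists of the parts of C(f), since every translate
    among the parts is isomorphic to [T]. A zero [T] is left off the list; otherwise [T] is
    indecomposable and not projective, hence differs from every [P k]. *)
Lemma irreducible_determiner B D (f : {linear B -> D}) Cf T n (P : 'I_n -> lmodType A) :
    fin_gen B -> irreducible_map f -> minimal_right_determiner f Cf ->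
    tau_inv (submod (mod_ker f)) T ->
    representatives (almost_factoring_projective f) P ->
  isomorphic Cf (T * dsum P)%type.
Proof.
move=> Bf firr [m [Z [[Zpart Zinj Zc] CfZ]]] kT [Ppart Pinj Pc].
apply: isomorphic_trans CfZ _.
have kf : fin_gen (submod (mod_ker f)).
  by apply: (fin_gen_inj (g := \val)) Bf _; apply: val_inj.
have tauT V : tau_inv_of_intrinsic_kernel f V -> isomorphic V T.
  move=> [_ [L [X [fL Xi /retractP XL XV]]]].
  have Xk := retract_trans XL (isomorphic_retract (irreducible_intrinsic_kernel
    firr Bf fL)).
  have X0 : ~ zero_module X by case: Xi.
  have ki : indecomposable (submod (mod_ker f)).
    apply: irreducible_kernel_indecomposable => // k0; apply: X0 => x.
    by have [i [r rK]] := Xk; rewrite -(rK x) (k0 (i x)) linear0.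
  exact: tau_inv_iso (indecomposable_retract ki Xk X0) XV kT.
have [T0|T0] := EM (zero_module T).
  have [i [r ir]] := zero_prod_dsum_biproduct P T0.
  apply: (representatives_biproduct_iso (dsum_biproduct Z) ir Zpart Zinj Zc) => //.
    by move=> k; right.
  move=> V [Vtau|]; last exact: Pc.
  have [V0 _] : indecomposable V by case: Vtau.
  by case: V0; apply: isomorphic_zero T0; apply: isomorphic_sym; apply: tauT.
have ki : indecomposable (submod (mod_ker f)).
  apply: irreducible_kernel_indecomposable => // k0; apply: T0.
  exact: tau_inv_zero kT k0.
have TP k : ~ isomorphic T (P k).
  move=> TPk; apply: T0; apply: tau_inv_not_projective kT _.
  by apply: retract_projective (isomorphic_retract TPk) _; case: (Ppart k).
have Tpart : determiner_part f T.
  left; split; first exact: tau_inv_indecomposable kT kf ki T0.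
  have [L fL] := intrinsic_kernel_exists f Bf.
  exists L, (submod (mod_ker f)); split=> //; apply/retractP/isomorphic_retract.
  exact/isomorphic_sym/irreducible_intrinsic_kernel.
have [i [r ir]] := prod_dsum_biproduct T P.
apply: (representatives_biproduct_iso (dsum_biproduct Z) ir Zpart Zinj Zc).
- by move=> [k|] //=; right.
- move=> [k|] [l|] //= kl; first by rewrite (Pinj k l).
    by case: (TP k); apply: isomorphic_sym.
  by case: (TP l).
move=> V [/tauT VT|/Pc[k VP]]; [by exists None | by exists (Some k)].
Qed.
End IrreducibleDeterminer.

(** C(f) enters as a relation, so its existence is asserted first and keeps the clauses about every
    [Cf] from being vacuous. *)
Theorem theorem2p4 (K : fieldType) (A : falgType K) (B D : lmodType A)
    (hB : fin_gen B) (hD : fin_gen D) (f : {linear B -> D}) :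
  (exists Cf : lmodType A, minimal_right_determiner f Cf) /\
  forall Cf : lmodType A, minimal_right_determiner f Cf ->
    (forall C : lmodType A, fin_gen C ->
       (right_determined f C <-> in_add C Cf)) /\
    (irreducible_map f ->
       exists (T : lmodType A) (n : nat) (P : 'I_n -> lmodType A),
         [/\ tau_inv (submod (mod_ker f)) T,
             representatives (almost_factoring_projective f) P
           & isomorphic Cf (T * dsum P)%type]).
Proof.
split.
  have [I [N fN]] := determiner_part_finite f hB.
  have [n [Z ZP]] := representativesP fN.
  by exists (dsum Z), n, Z; split=> //; apply: isomorphic_refl.
move=> Cf fCf; split=> [C|firr]; first exact: right_determinedP.
have kf : fin_gen (submod (mod_ker f)).
  by apply: (fin_gen_inj (g := \val)) hB _; apply: val_inj.
have [T kT] := tau_inv_exists kf.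
have [n [P PP]] := almost_factoring_representatives f.
by exists T, n, P; split=> //; apply: irreducible_determiner kT PP.
Qed.
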